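(* Let $(\Omega,\mathcal{F},\mu)$ be a $\sigma$-finite measure space with associated measure algebra $\mathcal{A}$. Then the conditional real numbers $\mathbf{R}$ with respect to $\mathcal{A}$ are in conditional bijection with $\mathbf{L^0}$, via a conditional bijection $\varphi:\mathbf{R}\to\mathbf{L^0}$ that preserves addition, multiplication and order, and such that $\varphi$ and $\varphi^{-1}$ are conditionally continuous for the conditional Euclidean topology on $\mathbf{R}$ and the conditional $L^0$-topology on $\mathbf{L^0}$.
   Context: $\mathcal{A}$ is the quotient of $\mathcal{F}$ by the $\mu$-null sets (a complete Boolean algebra); $p(a)$ is the set of families $(a_i)$ in $\mathcal A$ with $\bigvee a_i=a$, $a_i\wedge a_j=0$ ($i\ne j$). $L^0$ is the set of $\mu$-a.e. equivalence classes of real measurable functions. The conditional set $\mathbf{L^0}$ has components $X_a=\{1_AX: X\in L^0\}$ ($A$ a representative of $a$) and maps $\gamma_a(X)=1_AX$; its operations are pointwise, its order is a.e. dominance, and its conditional topology ($L^0$-topology) is generated by the base of balls $B_\varepsilon(f)=\{g\in L^0:|f-g|<\varepsilon\ \text{a.e.}\}$, $f\in L^0$, $\varepsilon\in L^0$ with $\varepsilon>0$ a.e. A conditional set $X=(X_a,\gamma_a)_{a\in\mathcal{A}}$ consists of sets and surjections $\gamma_a:X_1\to X_a$ ($X_0$ a singleton, $\gamma_1=\mathrm{id}$), consistent and stable (unique gluing $\sum a_ix_i$ over $(a_i)\in p(1)$); a conditional function is a family $f_a:X_a\to Y_a$ with $f_a(ax)=af_1(x)$; a conditional bijection has all $f_a$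 injective and $f_1$ surjective; conditional continuity means preimages of conditionally open sets are conditionally open. $\mathbf{Q}$, $\mathbf{N}$ are the conditional sets generated by $\mathbb{Q}$, $\mathbb N$ (elements $\sum a_iq_i$ with $(a_i)\in p(1)$, $q_i$ classical, operations and order defined piecewise). $\mathbf{R}$ is the conditional set of equivalence classes of conditionally Cauchy conditional sequences $(q_n)$ in $\mathbf Q$ (conditional functions $\mathbf N\to\mathbf Q$ with: for all $\varepsilon\in\mathbf{Q}$, $\varepsilon>0$, there is $n_0\in\mathbf{N}$ with $|q_n-q_m|<\varepsilon$ for $m,n\geqslant n_0$), modulo $(q_n)\sim(p_n)$ iff $q_n-p_n\to0$, with termwise operations and $[(p_n)]\leqslant[(q_n)]$ iff for each $\varepsilon>0$ in $\mathbf Q$ eventually $q_n-p_n>-\varepsilon$. The conditional Euclidean topology on $\mathbf{R}$ is generated by the balls $B_\varepsilon(x)=\{y:|x-y|<\varepsilon\}$, $x\in\mathbf{R}$, $\varepsilon\in\mathbf{R}$, $\varepsilon>0$ (where $x<y$ means $x\leqslant y$ and $ax=ay$ only for $a=0$). *)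

(* Defs.v *)
From HB Require Import structures.
From mathcomp Require Import all_boot all_order all_algebra.
From mathcomp Require Import all_classical all_reals all_analysis measurable_realfun.
From mathcomp Require Import ring lra.

Set Implicit Arguments.
Unset Strict Implicit.
Unset Printing Implicit Defensive.

Import Order.Theory GRing.Theory Num.Theory.

Local Open Scope order_scope.

HB.mixin Record hasArbitraryJoins (d : Order.disp_t) T
    of Order.CTBDistrLattice d T := {
  bigjoin : set T -> T;
  bigjoin_ub : forall (S : set T) x, S x -> x <= bigjoin S;
  bigjoin_le : forall (S : set T) y, (forall x, S x -> x <= y) -> bigjoin S <= y
}.

#[short(type="cboolAlgType")]
HB.structure Definition CompleteBooleanAlgebra (d : Order.disp_t) :=
  { T of Order.CTBDistrLattice d T & hasArbitraryJoins d T }.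

Definition partition_of (d : Order.disp_t) (A : cboolAlgType d) (I : Type)
    (a : I -> A) (b : A) : Prop :=
  (forall i j, i <> j -> a i `&` a j = \bot) /\ bigjoin (range a) = b.

Record condset (d : Order.disp_t) (A : cboolAlgType d) := CondSet {
  comp :> A -> Type;
  res : forall a : A, comp \top -> comp a;
  res_surj : forall a (y : comp a), exists x, res a x = y;
  comp_bot : exists x0 : comp \bot, forall x, x = x0;
  res_top : forall x, res \top x = x;
  res_consistent : forall a b x y, a <= b -> res b x = res b y ->
    res a x = res a y;
  res_stable : forall (I : Type) (a : I -> A) (x : I -> comp \top),
    partition_of a \top ->
    exists! y, forall i, res (a i) y = res (a i) (x i)
}.
Arguments res {d A} X a x : rename.

Record condfun (d : Order.disp_t) (A : cboolAlgType d) (X Y : condset A) :=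
  CondFun {
    cfun :> forall a : A, X a -> Y a;
    cfun_res : forall a x, cfun (res X a x) = res Y a (cfun x)
  }.
Arguments CondFun {d A X Y} cfun cfun_res.
Arguments cfun {d A X Y} f {a} x : rename.

Section ConditionalBijections.
Context (d : Order.disp_t) (A : cboolAlgType d) (X Y : condset A).

Definition cond_bijective (f : condfun X Y) : Prop :=
  (forall a : A, injective (@cfun _ _ _ _ f a)) /\
  (forall y : Y \top, exists x : X \top, f _ x = y).

Definition cond_inverse (f : condfun X Y) (g : condfun Y X) : Prop :=
  forall a : A, cancel (@cfun _ _ _ _ f a) (@cfun _ _ _ _ g a) /\
                cancel (@cfun _ _ _ _ g a) (@cfun _ _ _ _ f a).

End ConditionalBijections.

(* Conditional subsets are families of components; the one living on [a] has  *)
(* components [O b] for [b <= a] and is empty at the other levels.            *)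
Section ConditionalTopology.
Context (d : Order.disp_t) (A : cboolAlgType d) (X : condset A).

Definition cfamily : Type := forall a : A, set (X a).

Definition stable_set (Y : set (X \top)) : Prop :=
  (exists y, Y y) /\
  forall (I : Type) (a : I -> A) (x : I -> X \top) (y : X \top),
    partition_of a \top -> (forall i, Y (x i)) ->
    (forall i, res X (a i) y = res X (a i) (x i)) -> Y y.

Definition crestr (a : A) (O : cfamily) : cfamily :=
  fun b => [set x | b <= a /\ O b x]%classic.

Definition cgen (Y : set (X \top)) : cfamily :=
  fun a => [set res X a x | x in Y]%classic.

Definition is_csubset (O : cfamily) : Prop :=
  exists (a : A) (Y : set (X \top)), stable_set Y /\ O = crestr a (cgen Y).

Definition ctotal : cfamily := fun _ => setT.
Definition cempty : cfamily := crestr \bot ctotal.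

(* The componentwise intersection lives on the largest [a] such that          *)
(* [O1 a `&` O2 a] is nonempty.                                               *)
Definition cinter (O1 O2 : cfamily) : cfamily :=
  fun a => (O1 a `&` O2 a)%classic.

(* Level [a] of the union: all gluings, over partitions of [a], of elements   *)
(* of the [O i]; it lives on the join of the conditions of the [O i].         *)
Definition cunion (I : Type) (O : I -> cfamily) : cfamily :=
  fun a => [set x | exists (J : Type) (b : J -> A) (i : J -> I) (y : X \top),
    [/\ partition_of b a, x = res X a y &
        forall j, O (i j) (b j) (res X (b j) y)]]%classic.

Definition cglue (I : Type) (a : I -> A) (O : I -> cfamily) : cfamily :=
  cunion (fun i => crestr (a i) (O i)).

(* The last clause says that a conditional topology is a stable set in the    *)
(* conditional power set of [X].                                              *)
Definition is_ctopology (T : set cfamily) : Prop :=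
  [/\ forall O, T O -> is_csubset O,
      T ctotal /\ T cempty,
      forall O1 O2, T O1 -> T O2 -> T (cinter O1 O2),
      forall (I : Type) (O : I -> cfamily), (forall i, T (O i)) -> T (cunion O) &
      forall (I : Type) (a : I -> A) (O : I -> cfamily),
        partition_of a \top -> (forall i, T (O i)) -> T (cglue a O)].

Definition ctopology_generated (B : set cfamily) : set cfamily :=
  fun O => forall T : set cfamily,
    is_ctopology T -> (forall V, B V -> T V) -> T O.

End ConditionalTopology.

Section ConditionalContinuity.
Context (d : Order.disp_t) (A : cboolAlgType d) (X Y : condset A).

Definition cpreimage (f : condfun X Y) (O : cfamily Y) : cfamily X :=
  fun a => [set x | O a (f a x)]%classic.

Definition cond_continuous (TX : set (cfamily X)) (TY : set (cfamily Y))
    (f : condfun X Y) : Prop :=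
  forall O, TY O -> TX (cpreimage f O).

End ConditionalContinuity.

Definition clt (d : Order.disp_t) (A : cboolAlgType d) (X : condset A)
    (le : X \top -> X \top -> Prop) (x y : X \top) : Prop :=
  le x y /\ forall a : A, res X a x = res X a y -> a = \bot.

Section Forcing.
Context (d : Order.disp_t) (A : cboolAlgType d).
Implicit Types (a b c : A).

Lemma le_denseP a b :
  (forall c, c != \bot -> c <= a ->
     exists c', [/\ c' != \bot, c' <= c & c' <= b]) -> a <= b.
Proof.
move=> H; rewrite -[b]complK -disj_leC; apply/negPn/negP => n0.
have [c' [c'0 c'c c'b]] := H _ n0 (leIl _ _).
have : c' <= b `&` ~` b by rewrite lexI c'b (le_trans c'c) ?leIr.
by rewrite meetxC lex0 (negbTE c'0).
Qed.

Lemma bigjoin_meets (S : set A) c : c != \bot -> c <= bigjoin S ->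
  exists c', [/\ c' != \bot, c' <= c & exists2 s, S s & c' <= s].
Proof.
move=> c0 cS; apply: contrapT => H.
have : bigjoin S <= ~` c.
  apply: bigjoin_le => s Ss; rewrite -disj_leC; apply/negPn/negP => n0.
  by apply: H; exists (s `&` c); split; rewrite ?leIr//; exists s; rewrite ?leIl.
move=> /(le_trans cS); rewrite -disj_leC meetxx => /eqP c00.
by rewrite c00 eqxx in c0.
Qed.

Lemma partition_ofP (I : Type) (a : I -> A) b :
  (forall i j c, c != \bot -> c <= a i -> c <= a j -> i = j) ->
  (forall i, a i <= b) ->
  (forall c, c != \bot -> c <= b ->
     exists c', [/\ c' != \bot, c' <= c & exists i, c' <= a i]) ->
  partition_of a b.
Proof.
move=> dis le cov; split=> [i j ij|].
  apply/eqP/negPn/negP => n0; apply: ij.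
  exact: (dis _ _ _ n0 (leIl _ _) (leIr _ _)).
apply: le_anti; apply/andP; split.
  by apply: bigjoin_le => _ [i _ <-].
apply: le_denseP => c c0 cb; have [c' [c'0 c'c [i c'i]]] := cov c c0 cb.
exists c'; split => //; apply: le_trans c'i _; apply: bigjoin_ub.
by exists i.
Qed.

Lemma partition_uniq (I : Type) (a : I -> A) b i j c :
  partition_of a b -> c != \bot -> c <= a i -> c <= a j -> i = j.
Proof.
move=> [dis _] c0 ci cj; apply: contrapT => /dis aij.
by move: c0; rewrite -lex0 -aij lexI ci cj.
Qed.

Lemma partition_le (I : Type) (a : I -> A) b i : partition_of a b -> a i <= b.
Proof. by move=> [_ <-]; apply: bigjoin_ub; exists i. Qed.

Lemma partition_meets (I : Type) (a : I -> A) b c :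
  partition_of a b -> c != \bot -> c <= b ->
  exists c', [/\ c' != \bot, c' <= c & exists i, c' <= a i].
Proof.
move=> [_ <-] c0 /(bigjoin_meets c0)[c' [c'0 c'c [_ [i _ <-] c'i]]].
by exists c'; split => //; exists i.
Qed.

End Forcing.

(* The conditional set generated by a nonempty set [E]. An element            *)
(* [\sum_i a_i e_i] living on [a] is represented by the family                *)
(* [e |-> \bigvee_(i | e_i = e) a_i], a partition of [a] indexed by [E].      *)
Section GeneratedConditionalSet.
Context (d : Order.disp_t) (A : cboolAlgType d).

Record gelt (E : Type) (a : A) := GElt {
  gval :> E -> A;
  gvalP : partition_of gval a
}.

Section Basics.
Context (E : Type).
Implicit Types (a b c : A).

Lemma gelt_val_inj a (x y : gelt E a) : (forall e, x e = y e) -> x = y.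
Proof.
case: x => x xP; case: y => y yP /= /funext xy; case: y / xy yP => yP.
by congr GElt; exact: Prop_irrelevance.
Qed.

Lemma gelt_uniq a (x : gelt E a) c e e' :
  c != \bot -> c <= x e -> c <= x e' -> e = e'.
Proof. exact: partition_uniq (gvalP x). Qed.

Lemma gelt_le a (x : gelt E a) e : x e <= a.
Proof. exact: partition_le (gvalP x). Qed.

Lemma gelt_meets a (x : gelt E a) c : c != \bot -> c <= a ->
  exists c', [/\ c' != \bot, c' <= c & exists e, c' <= x e].
Proof. exact: partition_meets (gvalP x). Qed.

Lemma gelt_le_eq a (x y : gelt E a) :
  (forall c e f, c != \bot -> c <= x e -> c <= y f -> e = f) ->
  forall e, x e <= y e.
Proof.
move=> H e; apply: le_denseP => c c0 cx.
have [c' [c'0 c'c [f c'f]]] := gelt_meets y c0 (le_trans cx (gelt_le x e)).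
exists c'; split => //.
by rewrite (H c' e f) // (le_trans c'c).
Qed.

Lemma gelt_eq a (x y : gelt E a) :
  (forall c e f, c != \bot -> c <= x e -> c <= y f -> e = f) -> x = y.
Proof.
move=> H; apply: gelt_val_inj => e; apply: le_anti.
rewrite !gelt_le_eq // => c f g c0 cf cg.
by apply/esym/(H c).
Qed.

Definition gconst_fun (e e' : E) : A := if `[< e = e' >] then \top else \bot.

Lemma gconst_subproof e : partition_of (gconst_fun e) \top.
Proof.
rewrite /gconst_fun; apply: partition_ofP => [i j c c0||c c0 _].
- case: asboolP => [<- _|_]; last by rewrite lex0 (negbTE c0).
  by case: asboolP => [<-//|_]; rewrite lex0 (negbTE c0).
- by move=> i; rewrite lex1.
- by exists c; split => //; exists e; rewrite asboolT // lex1.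
Qed.

Definition gconst (e : E) : gelt E \top := GElt (gconst_subproof e).

Lemma gconst_le (e f : E) c : c != \bot -> c <= gconst e f -> e = f.
Proof.
rewrite /= /gconst_fun; case: asboolP => // _ c0.
by rewrite lex0 (negbTE c0).
Qed.

Lemma gres_subproof a (x : gelt E \top) :
  partition_of (fun e => a `&` x e) a.
Proof.
apply: partition_ofP => [i j c c0||c c0 ca].
- rewrite !lexI => /andP[_ ci] /andP[_ cj]; exact: gelt_uniq c0 ci cj.
- by move=> i; rewrite leIl.
- have [c' [c'0 c'c [e c'e]]] := gelt_meets x c0 (lex1 _).
  by exists c'; split => //; exists e; rewrite lexI c'e (le_trans c'c).
Qed.

Definition gres a (x : gelt E \top) : gelt E a := GElt (gres_subproof a x).

Lemma gres_top x : gres \top x = x.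
Proof. by apply: gelt_val_inj => e /=; rewrite meet1x. Qed.

Lemma gres_consistent a b x y :
  a <= b -> gres b x = gres b y -> gres a x = gres a y.
Proof.
move=> ab xy; apply: gelt_val_inj => e /=.
have /(congr1 (fun z : gelt E b => gval z e))/= := xy.
by move=> /(congr1 (Order.meet a)); rewrite !meetA (meet_l ab).
Qed.

Lemma gresP a x y : gres a x = gres a y <->
  (forall c e f, c != \bot -> c <= a -> c <= x e -> c <= y f -> e = f).
Proof.
split=> [xy c e f c0 ca ce cf|H].
  apply: (gelt_uniq (x := gres a x) c0).
    by rewrite /= lexI ca.
  by rewrite xy /= lexI ca.
apply: gelt_eq => c e f c0 /=; rewrite !lexI => /andP[ca ce] /andP[_ cf].
exact: H ce cf.
Qed.

Lemma gelt_bot (x y : gelt E \bot) : x = y.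
Proof.
apply: gelt_eq => c e f c0 /le_trans/(_ (gelt_le _ _)).
by rewrite lex0 (negbTE c0).
Qed.

Section Glue.
Context (I : Type) (a : I -> A) (aP : partition_of a \top) (b : A).
Context (x : I -> gelt E b).

Definition gglue_fun e : A := bigjoin (range (fun i => a i `&` x i e)).

Lemma gglue_le i e c : c <= a i -> c <= x i e -> c <= gglue_fun e.
Proof.
move=> ca cx; apply: (@le_trans _ _ (a i `&` x i e)); first by rewrite lexI ca.
by apply: bigjoin_ub; exists i.
Qed.

Lemma gglue_meets e c : c != \bot -> c <= gglue_fun e ->
  exists c' i, [/\ c' != \bot, c' <= c, c' <= a i & c' <= x i e].
Proof.
move=> c0 /(bigjoin_meets c0)[c' [c'0 c'c [_ [i _ <-]]]].
by rewrite lexI => /andP[ci ce]; exists c', i.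
Qed.

Lemma gglue_subproof : partition_of gglue_fun b.
Proof.
apply: partition_ofP => [e f c c0 ce cf|e|c c0 cb].
- have [c1 [i [c10 c1c c1i c1e]]] := gglue_meets c0 ce.
  have [c2 [j [c20 c2c c2j c2e]]] := gglue_meets c10 (le_trans c1c cf).
  have ij := partition_uniq aP c20 (le_trans c2c c1i) c2j.
  rewrite -ij in c2e.
  exact: gelt_uniq c20 (le_trans c2c c1e) c2e.
- apply: bigjoin_le => _ [i _ <-]; exact: le_trans (leIr _ _) (gelt_le _ _).
- have [c1 [c10 c1c [i c1i]]] := partition_meets aP c0 (lex1 _).
  have [c2 [c20 c2c [e c2e]]] := gelt_meets (x i) c10 (le_trans c1c cb).
  exists c2; split; rewrite ?(le_trans c2c)//; exists e.
  exact: gglue_le (le_trans c2c c1i) c2e.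
Qed.

Definition gglue : gelt E b := GElt gglue_subproof.

Lemma gglueP c i e f : c != \bot -> c <= a i -> c <= gglue e -> c <= x i f ->
  e = f.
Proof.
by move=> c0 ci ce cf; apply: (gelt_uniq c0 ce); exact: gglue_le ci cf.
Qed.

End Glue.

End Basics.

Section GeneratedCondset.
Context (E : pointedType).
Implicit Types (a b c : A).

Definition gextend_fun a (x : gelt E a) (e : E) : A :=
  if `[< e = point >] then x e `|` ~` a else x e.

Lemma gextend_subproof a (x : gelt E a) : partition_of (gextend_fun x) \top.
Proof.
have low c e : c <= a -> c <= gextend_fun x e -> c <= x e.
  move=> ca; rewrite /gextend_fun; case: asboolP => // _ ce.
  rewrite -(meet_l ce) meetUr.
  have -> : c `&` ~` a = \bot by apply/eqP; rewrite disj_leC complK.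
  by rewrite joinx0 leIr.
have high c e : c != \bot -> c <= ~` a -> c <= gextend_fun x e -> e = point.
  move=> c0 ca; rewrite /gextend_fun; case: asboolP => // _ ce.
  have : c <= a `&` ~` a by rewrite lexI ca (le_trans ce (gelt_le _ _)).
  by rewrite meetxC lex0 (negbTE c0).
apply: partition_ofP => [e f c c0 ce cf|e|c c0 _].
- have [ca|/negP] := eqVneq (c `&` a) \bot.
    have {}ca : c <= ~` a by rewrite -disj_leC ca.
    by rewrite (high c e) // (high c f).
  move=> /negP ca0; apply: (gelt_uniq (x := x) ca0).
    by apply: low; rewrite ?leIr // (le_trans (leIl _ _)).
  by apply: low; rewrite ?leIr // (le_trans (leIl _ _)).
- by rewrite lex1.
- have [ca|ca0] := eqVneq (c `&` a) \bot.
    have {}ca : c <= ~` a by rewrite -disj_leC ca.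
    exists c; split => //; exists point.
    by rewrite /gextend_fun asboolT // (le_trans ca) ?leUr.
  have [c' [c'0 c'c [e c'e]]] := gelt_meets x ca0 (leIr _ _).
  exists c'; split; rewrite ?(le_trans c'c) ?leIl//; exists e.
  by rewrite /gextend_fun; case: asboolP => // _; rewrite (le_trans c'e) ?leUl.
Qed.

Definition gextend a (x : gelt E a) : gelt E \top := GElt (gextend_subproof x).

Lemma gres_surj a (y : gelt E a) : exists x, gres a x = y.
Proof.
exists (gextend y); apply: gelt_eq => c e f c0 /=.
rewrite lexI /gextend_fun => /andP[ca ce] cf.
apply: (gelt_uniq (x := y) c0) => //.
move: ce; case: asboolP => // _ ce.
rewrite -(meet_l ce) meetUr.
have -> : c `&` ~` a = \bot by apply/eqP; rewrite disj_leC complK.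
by rewrite joinx0 leIr.
Qed.

Lemma gcomp_bot : exists x0 : gelt E \bot, forall x, x = x0.
Proof. by exists (gres \bot (gconst point)) => x; exact: gelt_bot. Qed.

Lemma gres_stable (I : Type) (a : I -> A) (x : I -> gelt E \top) :
  partition_of a \top ->
  exists! y, forall i, gres (a i) y = gres (a i) (x i).
Proof.
move=> aP; exists (gglue aP x); split=> [i|y yx].
  apply/gresP => c e f c0 ca ce cf; exact: gglueP ca ce cf.
apply: gelt_eq => c e f c0 ce cf.
have [c1 [c10 c1c [i c1i]]] := partition_meets aP c0 (lex1 _).
have [c2 [c20 c2c [g c2g]]] := gelt_meets (x i) c10 (lex1 _).
have ci := le_trans c2c c1i; have cc := le_trans c2c c1c.
have -> : e = g by apply: gglueP c20 ci (le_trans cc ce) c2g.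
apply/esym; move: (yx i) => /gresP/(_ c2); apply => //.
exact: le_trans cc cf.
Qed.

Definition gcondset : condset A :=
  CondSet gres_surj gcomp_bot (@gres_top E) (@gres_consistent E) gres_stable.

End GeneratedCondset.

Section PiecewiseOperations.
Context (E F G : Type) (b : A).

Definition gmap1_fun (h : E -> F) (x : gelt E b) (f : F) : A :=
  bigjoin [set x e | e in [set e | h e = f]]%classic.

Lemma gmap1_le h x e c : c <= gval x e -> c <= gmap1_fun h x (h e).
Proof. by move=> ce; apply: le_trans ce _; apply: bigjoin_ub; exists e. Qed.

Lemma gmap1_subproof h x : partition_of (gmap1_fun h x) b.
Proof.
apply: partition_ofP => [f f' c c0 cf cf'|f|c c0 cb].
- have [c1 [c10 c1c [_ [e ef <-] c1e]]] := bigjoin_meets c0 cf.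
  have [c2 [c20 c2c [_ [e' ef' <-] c2e]]] :=
    bigjoin_meets c10 (le_trans c1c cf').
  by rewrite -ef -ef' (gelt_uniq c20 (le_trans c2c c1e) c2e).
- by apply: bigjoin_le => _ [e _ <-]; exact: gelt_le.
- have [c1 [c10 c1c [e c1e]]] := gelt_meets x c0 cb.
  by exists c1; split => //; exists (h e); exact: gmap1_le.
Qed.

Definition gmap1 (h : E -> F) (x : gelt E b) : gelt F b :=
  GElt (gmap1_subproof h x).

(* [(\sum_i a_i e_i, \sum_j b_j f_j) |-> \sum_(i,j) (a_i /\ b_j) h(e_i, f_j)] *)
Definition gmap2_fun (h : E -> F -> G) (x : gelt E b) (y : gelt F b) (g : G)
    : A :=
  bigjoin [set (x ef.1 `&` y ef.2)%O | ef in [set ef | h ef.1 ef.2 = g]]%classic.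

Lemma gmap2_le h x y e f c :
  c <= gval x e -> c <= gval y f -> c <= gmap2_fun h x y (h e f).
Proof.
move=> ce cf; apply: (@le_trans _ _ (x e `&` y f)); first by rewrite lexI ce.
by apply: bigjoin_ub; exists (e, f).
Qed.

Lemma gmap2_subproof h x y : partition_of (gmap2_fun h x y) b.
Proof.
apply: partition_ofP => [g g' c c0 cg cg'|g|c c0 cb].
- have [c1 [c10 c1c [_ [[e f] /= efg <-]]]] := bigjoin_meets c0 cg.
  rewrite lexI => /andP[c1e c1f].
  have [c2 [c20 c2c [_ [[e' f'] /= efg' <-]]]] :=
    bigjoin_meets c10 (le_trans c1c cg').
  rewrite lexI => /andP[c2e c2f].
  rewrite -efg -efg' (gelt_uniq c20 (le_trans c2c c1e) c2e).
  by rewrite (gelt_uniq c20 (le_trans c2c c1f) c2f).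
- apply: bigjoin_le => _ [[e f] _ <-] /=.
  exact: le_trans (leIl _ _) (gelt_le _ _).
- have [c1 [c10 c1c [e c1e]]] := gelt_meets x c0 cb.
  have [c2 [c20 c2c [f c2f]]] := gelt_meets y c10 (le_trans c1c cb).
  exists c2; split; rewrite ?(le_trans c2c)//; exists (h e f).
  by apply: gmap2_le => //; exact: le_trans c2c c1e.
Qed.

Definition gmap2 (h : E -> F -> G) (x : gelt E b) (y : gelt F b) : gelt G b :=
  GElt (gmap2_subproof h x y).

(* [r e_i f_j] whenever the pieces [a_i] and [b_j] meet *)
Definition grel (r : E -> F -> Prop) (x : gelt E b) (y : gelt F b) : Prop :=
  forall e f, x e `&` y f != \bot -> r e f.

Lemma grelP r x y : grel r x y <->
  forall c e f, c != \bot -> c <= gval x e -> c <= gval y f -> r e f.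
Proof.
split=> [rxy c e f c0 ce cf|H e f n0].
  apply: rxy; apply: contra_neqT (c0) => /negPn/eqP xy0.
  by apply/eqP; rewrite -lex0 -xy0 lexI ce.
exact: H n0 (leIl _ _) (leIr _ _).
Qed.

Lemma gmap1P h x c e f :
  c != \bot -> c <= gmap1 h x f -> c <= gval x e -> f = h e.
Proof. by move=> c0 cf ce; apply: (gelt_uniq c0 cf); exact: gmap1_le. Qed.

Lemma gmap2P h x y c e f g :
  c != \bot -> c <= gmap2 h x y g -> c <= gval x e -> c <= gval y f ->
  g = h e f.
Proof. by move=> c0 cg ce cf; apply: (gelt_uniq c0 cg); exact: gmap2_le. Qed.

End PiecewiseOperations.

Lemma gmap1_res (E F : Type) (h : E -> F) a (x : gelt E \top) :
  gmap1 h (gres a x) = gres a (gmap1 h x).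
Proof.
apply: gelt_eq => c g g' c0 cg /=; rewrite lexI => /andP[ca cg'].
have [c1 [c10 c1c [e c1e]]] := gelt_meets x c0 (lex1 _).
have -> : g = h e.
  by apply: (gmap1P c10 (le_trans c1c cg)); rewrite /= lexI (le_trans c1c ca).
by rewrite (gmap1P c10 (le_trans c1c cg') c1e).
Qed.

Lemma gmap2_res (E F G : Type) (h : E -> F -> G) a
    (x : gelt E \top) (y : gelt F \top) :
  gmap2 h (gres a x) (gres a y) = gres a (gmap2 h x y).
Proof.
apply: gelt_eq => c g g' c0 cg /=; rewrite lexI => /andP[ca cg'].
have [c1 [c10 c1c [e c1e]]] := gelt_meets x c0 (lex1 _).
have [c2 [c20 c2c [f c2f]]] := gelt_meets y c10 (lex1 _).
have cc := le_trans c2c c1c; have ce := le_trans c2c c1e.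
have -> : g = h e f.
  by apply: (gmap2P c20 (le_trans cc cg)); rewrite /= lexI (le_trans cc ca).
by rewrite (gmap2P c20 (le_trans cc cg') ce c2f).
Qed.

End GeneratedConditionalSet.

Section ConditionalRationals.
Context (d : Order.disp_t) (A : cboolAlgType d).

Definition cnat : condset A := gcondset A nat.
Definition crat : condset A := gcondset A rat.

Definition cratc (r : rat) : crat \top := gconst A r.

Definition cnat_le (a : A) : cnat a -> cnat a -> Prop :=
  grel (fun m n : nat => (m <= n)%N).

(* Strict on every nonzero piece, so that [a x = a y] only for [a = \bot] *)
Definition crat_lt (a : A) : crat a -> crat a -> Prop :=
  grel (fun x y : rat => (x < y)%R).

Definition crat_add (a : A) : crat a -> crat a -> crat a :=
  gmap2 (fun x y : rat => (x + y)%R).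

Definition crat_sub (a : A) : crat a -> crat a -> crat a :=
  gmap2 (fun x y : rat => (x - y)%R).

Definition crat_mul (a : A) : crat a -> crat a -> crat a :=
  gmap2 (fun x y : rat => (x * y)%R).

Definition crat_opp (a : A) : crat a -> crat a :=
  gmap1 (fun x : rat => (- x)%R).

Definition crat_abs (a : A) : crat a -> crat a :=
  gmap1 (fun x : rat => `|x|%R).

Definition cseq := condfun cnat crat.

Definition cseq_const (r : rat) : cseq.
Proof.
refine (@CondFun _ _ cnat crat (fun a _ => res crat a (cratc r)) _).
by move=> a x; rewrite res_top.
Defined.

Definition cseq_add (p q : cseq) : cseq.
Proof.
refine (@CondFun _ _ cnat crat (fun a n => crat_add (p a n) (q a n)) _).
by move=> a n; rewrite !cfun_res; exact: gmap2_res.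
Defined.

Definition cseq_sub (p q : cseq) : cseq.
Proof.
refine (@CondFun _ _ cnat crat (fun a n => crat_sub (p a n) (q a n)) _).
by move=> a n; rewrite !cfun_res; exact: gmap2_res.
Defined.

Definition cseq_mul (p q : cseq) : cseq.
Proof.
refine (@CondFun _ _ cnat crat (fun a n => crat_mul (p a n) (q a n)) _).
by move=> a n; rewrite !cfun_res; exact: gmap2_res.
Defined.

Definition cseq_abs (p : cseq) : cseq.
Proof.
refine (@CondFun _ _ cnat crat (fun a n => crat_abs (p a n)) _).
by move=> a n; rewrite !cfun_res; exact: gmap1_res.
Defined.

Definition ccauchy (q : cseq) : Prop :=
  forall eps : crat \top, crat_lt (cratc 0) eps ->
    exists n0 : cnat \top, forall m n : cnat \top,
      cnat_le n0 m -> cnat_le n0 n ->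
      crat_lt (crat_abs (crat_sub (q _ n) (q _ m))) eps.

(* [a q_n] tends to [0] in the component [crat a]; for [a = \top], [q_n -> 0] *)
Definition ctends0 (a : A) (q : cseq) : Prop :=
  forall eps : crat \top, crat_lt (cratc 0) eps ->
    exists n0 : cnat \top, forall n : cnat \top, cnat_le n0 n ->
      crat_lt (res crat a (crat_abs (q _ n))) (res crat a eps).

End ConditionalRationals.
Arguments cnat {d A}.
Arguments crat {d A}.
Arguments cratc {d A} r.

(* [gsplit x e xe] shrinks the nonzero condition [c] of the context, and every *)
(* hypothesis [c <= _], so that [x] takes the single value [e] on it.         *)
Ltac gsplit x e xe :=
  match goal with
  | c0 : is_true (?c != \bot) |- _ =>
    let c' := fresh "c" in let c'0 := fresh "c0" in let c'c := fresh "cc" in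
    have [c' [c'0 c'c [e xe]]] := gelt_meets x c0 (lex1 c);
    repeat match goal with H : is_true (c <= _) |- _ =>
      move: H => /(le_trans c'c) H end;
    clear c'c c0; clear c; rename c' into c; rename c'0 into c0
  end.

Section CauchySequences.
Context (d : Order.disp_t) (A : cboolAlgType d).
Local Notation cnat := (@cnat d A).
Local Notation crat := (@crat d A).
Local Notation cseq := (cseq A).
Implicit Types (a b c : A) (p q r : cseq) (eps : crat \top).

Lemma crat_lt_resP a (x y : crat \top) :
  crat_lt (res crat a x) (res crat a y) <->
  forall c e f, c != \bot -> c <= a -> c <= gval x e -> c <= gval y f ->
    (e < f)%R.
Proof.
split=> [/grelP H c e f c0 ca ce cf|H].
  by apply: (H c) => //=; rewrite lexI ca.
apply/grelP => c e f c0 /=; rewrite !lexI => /andP[ca ce] /andP[_ cf].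
exact: H ce cf.
Qed.

Lemma crat_gt0P eps : crat_lt (cratc 0) eps <->
  forall c e, c != \bot -> c <= gval eps e -> (0 < e)%R.
Proof.
split=> [/grelP H c e c0 ce|H].
  by apply: (H c) => //=; rewrite /gconst_fun asboolT ?lex1.
apply/grelP => c e f c0 /(gconst_le c0) <-; exact: H.
Qed.

Lemma crat_gt0_map1 (h : rat -> rat) eps :
  (forall e, 0 < e -> 0 < h e)%R ->
  crat_lt (cratc 0) eps -> crat_lt (cratc 0) (gmap1 h eps).
Proof.
move=> hpos /crat_gt0P H; apply/crat_gt0P => c e c0 ce.
gsplit eps f hf; rewrite (gmap1P c0 ce hf).
exact/hpos/(H _ _ c0 hf).
Qed.

Lemma crat_gt0c (e : rat) : (0 < e)%R -> crat_lt (A := A) (cratc 0) (cratc e).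
Proof. by move=> e0; apply/crat_gt0P => c f c0 /(gconst_le c0) <-. Qed.

Lemma cnat_le_trans : forall l m n : cnat \top,
  cnat_le l m -> cnat_le m n -> cnat_le l n.
Proof.
move=> l m n /grelP lm /grelP mn; apply/grelP => c e g c0 ce cg.
gsplit m f hf; exact: leq_trans (lm _ _ _ c0 ce hf) (mn _ _ _ c0 hf cg).
Qed.

Lemma cnat_le_refl (n : cnat \top) : cnat_le n n.
Proof. by apply/grelP => c e f c0 ce cf; rewrite (gelt_uniq c0 ce cf). Qed.

Definition cnat_max (m n : cnat \top) : cnat \top := gmap2 maxn m n.

Lemma cnat_le_maxl (m n : cnat \top) : cnat_le m (cnat_max m n).
Proof.
apply/grelP => c e f c0 ce cf; gsplit n g hg.
by rewrite (gmap2P c0 cf ce hg) leq_maxl.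
Qed.

Lemma cnat_le_maxr (m n : cnat \top) : cnat_le n (cnat_max m n).
Proof.
apply/grelP => c e f c0 ce cf; gsplit m g hg.
by rewrite (gmap2P c0 cf hg ce) leq_maxr.
Qed.

Arguments cnat_le_maxl m n : clear implicits.
Arguments cnat_le_maxr m n : clear implicits.
Arguments cnat_le_refl n : clear implicits.
Arguments cnat_le_trans {l m n} _ _.

(* The values of [|x - y|] and [eps] compare as the values of [x], [y], [eps] *)
Lemma crat_dist_ltP (x y eps : crat \top) :
  crat_lt (crat_abs (crat_sub x y)) eps <->
  forall c e f g, c != \bot -> c <= gval x e -> c <= gval y f ->
    c <= gval eps g -> (`|e - f| < g)%R.
Proof.
split=> [/grelP H c e f g c0 ce cf cg|H].
  apply: (H c) => //; apply: gmap1_le; exact: gmap2_le.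
apply/grelP => c e g c0 ce cg.
gsplit x u hu; gsplit y v hv.
have -> : e = `|u - v|%R by apply: (gmap1P c0 ce); exact: gmap2_le.
exact: H hu hv cg.
Qed.

Lemma cseq_const_cauchy (r : rat) : ccauchy (cseq_const A r).
Proof.
move=> eps /crat_gt0P eps0; exists (gconst A 0%N) => m n _ _.
apply/crat_dist_ltP => c e f g c0 /= + + cg.
rewrite !meet1x => /(gconst_le c0) <- /(gconst_le c0) <-.
by rewrite subrr normr0; exact: eps0 cg.
Qed.

Lemma cseq_lip_cauchy (h : rat -> rat -> rat) p q r :
  (forall x y x' y', `|h x y - h x' y'| <= `|x - x'| + `|y - y'|)%R ->
  (forall n : cnat \top, r _ n = gmap2 h (p _ n) (q _ n)) ->
  ccauchy p -> ccauchy q -> ccauchy r.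
Proof.
move=> hlip rE pC qC eps eps0.
pose eps2 : crat \top := gmap1 (fun e : rat => e / 2)%R eps.
have eps20 : crat_lt (cratc 0) eps2.
  by apply: crat_gt0_map1 => // e; lra.
have [n1 n1P] := pC _ eps20; have [n2 n2P] := qC _ eps20.
exists (cnat_max n1 n2) => m n mM nM.
have l1 := cnat_le_maxl n1 n2; have l2 := cnat_le_maxr n1 n2.
have := n1P m n (cnat_le_trans l1 mM) (cnat_le_trans l1 nM).
have := n2P m n (cnat_le_trans l2 mM) (cnat_le_trans l2 nM).
move=> /crat_dist_ltP qlt /crat_dist_ltP plt.
apply/crat_dist_ltP => c e f g c0; rewrite !rE => ce cf cg.
gsplit (p _ n) pn hpn; gsplit (p _ m) pm hpm.
gsplit (q _ n) qn hqn; gsplit (q _ m) qm hqm.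
rewrite (gmap2P c0 ce hpn hqn) (gmap2P c0 cf hpm hqm).
have cg2 : c <= gval eps2 (g / 2)%R by apply: gmap1_le.
have := plt _ _ _ _ c0 hpn hpm cg2; have := qlt _ _ _ _ c0 hqn hqm cg2.
have := hlip pn qn pm qm; lra.
Qed.

Lemma cseq_add_cauchy p q : ccauchy p -> ccauchy q -> ccauchy (cseq_add p q).
Proof.
apply: cseq_lip_cauchy => // x y x' y'.
by rewrite opprD addrACA ler_normD.
Qed.

Lemma cseq_sub_cauchy p q : ccauchy p -> ccauchy q -> ccauchy (cseq_sub p q).
Proof.
apply: cseq_lip_cauchy => // x y x' y'.
rewrite (_ : x - y - _ = (x - x') - (y - y'))%R; first exact: ler_normB.
lra.
Qed.

Lemma cseq_abs_cauchy p : ccauchy p -> ccauchy (cseq_abs p).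
Proof.
move=> pC eps eps0; have [n0 n0P] := pC _ eps0; exists n0 => m n n0m n0n.
have /crat_dist_ltP plt := n0P m n n0m n0n.
apply/crat_dist_ltP => c e f g c0 ce cf cg.
gsplit (p _ n) pn hpn; gsplit (p _ m) pm hpm.
rewrite (gmap1P c0 ce hpn) (gmap1P c0 cf hpm).
exact: le_lt_trans (ler_dist_dist _ _) (plt _ _ _ _ c0 hpn hpm cg).
Qed.

Lemma cseq_mul_cauchy p q : ccauchy p -> ccauchy q -> ccauchy (cseq_mul p q).
Proof.
move=> pC qC eps eps0.
have [m1 m1P] := pC _ (crat_gt0c ltr01); have [m2 m2P] := qC _ (crat_gt0c ltr01).
pose del : crat \top := gmap2 (fun e k : rat => e / k)%R eps
  (gmap2 (fun x y : rat => (`|x| + `|y| + 2) *+ 2)%R (p _ m1) (q _ m2)).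
have del0 : crat_lt (cratc 0) del.
  apply/crat_gt0P => c e c0 ce.
  gsplit eps g hg; gsplit (p _ m1) u hu; gsplit (q _ m2) v hv.
  rewrite (gmap2P c0 ce hg (gmap2_le _ hu hv)).
  apply: divr_gt0; first by move/crat_gt0P: eps0 => /(_ c g c0 hg).
  by rewrite pmulrn_lgt0 //; have := normr_ge0 u; have := normr_ge0 v; lra.
have [n1 n1P] := pC _ del0; have [n2 n2P] := qC _ del0.
exists (cnat_max (cnat_max m1 m2) (cnat_max n1 n2)) => m n mM nM.
have l1 := cnat_le_trans (cnat_le_maxl m1 m2) (cnat_le_maxl _ (cnat_max n1 n2)).
have l2 := cnat_le_trans (cnat_le_maxr m1 m2) (cnat_le_maxl _ (cnat_max n1 n2)).
have l3 := cnat_le_trans (cnat_le_maxl n1 n2) (cnat_le_maxr (cnat_max m1 m2) _).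
have l4 := cnat_le_trans (cnat_le_maxr n1 n2) (cnat_le_maxr (cnat_max m1 m2) _).
have := m1P m1 n (cnat_le_refl _) (cnat_le_trans l1 nM).
have := m2P m2 m (cnat_le_refl _) (cnat_le_trans l2 mM).
have := n1P m n (cnat_le_trans l3 mM) (cnat_le_trans l3 nM).
have := n2P m n (cnat_le_trans l4 mM) (cnat_le_trans l4 nM).
move=> /crat_dist_ltP qlt /crat_dist_ltP plt /crat_dist_ltP qbd /crat_dist_ltP pbd.
apply/crat_dist_ltP => c e f g c0 ce cf cg.
gsplit (p _ n) pn hpn; gsplit (p _ m) pm hpm.
gsplit (q _ n) qn hqn; gsplit (q _ m) qm hqm.
gsplit (p _ m1) u hu; gsplit (q _ m2) v hv.
rewrite (gmap2P c0 ce hpn hqn) (gmap2P c0 cf hpm hqm).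
have c1 : c <= gval (@cratc d A 1) 1%R by rewrite /= /gconst_fun asboolT ?lex1.
have := pbd _ _ _ _ c0 hpn hu c1; have := qbd _ _ _ _ c0 hqm hv c1.
pose K := ((`|u| + `|v| + 2) *+ 2)%R.
have cdel : c <= gval del (g / K)%R by apply: gmap2_le => //; exact: gmap2_le.
have := plt _ _ _ _ c0 hpn hpm cdel; have := qlt _ _ _ _ c0 hqn hqm cdel.
have g0 : (0 < g)%R by move/crat_gt0P: eps0 => /(_ c g c0 cg).
move: (normr_ge0 u) (normr_ge0 v) => u0 v0.
have K0 : (0 < K)%R by rewrite /K; lra.
have eg : (g = g / K * K)%R by rewrite divfK // gt_eqF.
move: (g / K)%R eg => D eg qD pD qv pu.
have D0 : (0 < D)%R by have := normr_ge0 (pn - pm)%R; lra.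
have pnB : (`|pn| <= `|u| + 1)%R.
  by have := ler_normD (pn - u)%R u; rewrite subrK; lra.
have qmB : (`|qm| <= `|v| + 1)%R.
  by have := ler_normD (qm - v)%R v; rewrite subrK; lra.
have -> : (pn * qn - pm * qm = pn * (qn - qm) + (pn - pm) * qm)%R by ring.
apply: le_lt_trans (ler_normD _ _) _; rewrite !normrM.
have e1 : (`|pn| * `|qn - qm| <= (`|u| + 1) * D)%R by apply: ler_pM => //; lra.
have e2 : (`|pn - pm| * `|qm| <= D * (`|v| + 1))%R by apply: ler_pM => //; lra.
apply: le_lt_trans (lerD e1 e2) _; rewrite eg /K; nra.
Qed.

End CauchySequences.
Arguments cnat_le_maxl {d A} m n.
Arguments cnat_le_maxr {d A} m n.
Arguments cnat_le_trans {d A l m n} _ _.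

Section ConditionalReals.
Context (d : Order.disp_t) (A : cboolAlgType d).
Local Notation cnat := (@cnat d A).
Local Notation crat := (@crat d A).
Local Notation cseq := (cseq A).
Implicit Types (a b c : A) (eps : crat \top).

Record cauchyseq := CauchySeq {
  cauchyseq_val :> condfun cnat crat;
  cauchyseqP : ccauchy cauchyseq_val
}.
Implicit Types (p q r : cauchyseq).

HB.instance Definition _ := gen_eqMixin cauchyseq.
HB.instance Definition _ := gen_choiceMixin cauchyseq.

Definition cauchyseq_const (r : rat) : cauchyseq :=
  CauchySeq (@cseq_const_cauchy d A r).
Definition cauchyseq_add p q : cauchyseq :=
  CauchySeq (cseq_add_cauchy (cauchyseqP p) (cauchyseqP q)).
Definition cauchyseq_sub p q : cauchyseq :=
  CauchySeq (cseq_sub_cauchy (cauchyseqP p) (cauchyseqP q)).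
Definition cauchyseq_mul p q : cauchyseq :=
  CauchySeq (cseq_mul_cauchy (cauchyseqP p) (cauchyseqP q)).
Definition cauchyseq_abs p : cauchyseq :=
  CauchySeq (cseq_abs_cauchy (cauchyseqP p)).

(* [a p ~ a q]; for [a = \top] this is the relation [p ~ q] *)
Definition cauchyseq_eqv (a : A) : rel cauchyseq :=
  fun p q => `[< ctends0 a (cseq_sub p q) >].

Lemma ctends0_subP a p q : ctends0 a (cseq_sub p q) <->
  forall eps, crat_lt (cratc 0) eps ->
    exists n0 : cnat \top, forall n : cnat \top, cnat_le n0 n ->
      forall c e f g, c != \bot -> c <= a -> c <= gval (p _ n) e ->
        c <= gval (q _ n) f -> c <= gval eps g -> (`|e - f| < g)%R.
Proof.
split=> H eps eps0; have [n0 n0P] := H _ eps0; exists n0 => n /n0P.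
  move=> /crat_lt_resP K c e f g c0 ca ce cf cg; apply: (K c) => //.
  by apply: gmap1_le; exact: gmap2_le.
move=> K; apply/crat_lt_resP => c e g c0 ca ce cg.
gsplit (p _ n) u hu; gsplit (q _ n) v hv.
by rewrite (gmap1P c0 ce (gmap2_le _ hu hv)); exact: K hu hv cg.
Qed.

Lemma cauchyseq_eqv_refl a : reflexive (cauchyseq_eqv a).
Proof.
move=> p; apply/asboolP/ctends0_subP => eps /crat_gt0P eps0.
exists (gconst A 0%N) => n _ c e f g c0 ca ce cf cg.
by rewrite (gelt_uniq c0 ce cf) subrr normr0; exact: eps0 cg.
Qed.

Lemma cauchyseq_eqv_sym a : symmetric (cauchyseq_eqv a).
Proof.
suff H p q : cauchyseq_eqv a p q -> cauchyseq_eqv a q p.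
  by move=> p q; apply/idP/idP; exact: H.
move=> /asboolP/ctends0_subP pq; apply/asboolP/ctends0_subP => eps eps0.
have [n0 n0P] := pq _ eps0; exists n0 => n n0n c e f g c0 ca ce cf cg.
by rewrite distrC; exact: (n0P _ n0n c).
Qed.

Lemma cauchyseq_eqv_trans a : transitive (cauchyseq_eqv a).
Proof.
move=> q p r /asboolP/ctends0_subP pq /asboolP/ctends0_subP qr.
apply/asboolP/ctends0_subP => eps eps0.
pose eps2 : crat \top := gmap1 (fun e : rat => e / 2)%R eps.
have eps20 : crat_lt (cratc 0) eps2.
  by apply: crat_gt0_map1 => // e; lra.
have [n1 n1P] := pq _ eps20; have [n2 n2P] := qr _ eps20.
exists (cnat_max n1 n2) => n nM c e f g c0 ca ce cf cg.
gsplit (q _ n) u hu.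
have cg2 : c <= gval eps2 (g / 2)%R by apply: gmap1_le.
have := n1P _ (cnat_le_trans (cnat_le_maxl _ _) nM) _ _ _ _ c0 ca ce hu cg2.
have := n2P _ (cnat_le_trans (cnat_le_maxr _ _) nM) _ _ _ _ c0 ca hu cf cg2.
have := ler_normD (e - u)%R (u - f)%R; rewrite addrA subrK; lra.
Qed.

Canonical cauchyseq_equiv a := EquivRel (cauchyseq_eqv a)
  (@cauchyseq_eqv_refl a) (@cauchyseq_eqv_sym a) (@cauchyseq_eqv_trans a).

Local Open Scope quotient_scope.

(* The component at [a]: classes [a[p]] of Cauchy sequences [p] modulo        *)
(* [a p ~ a q].                                                               *)
Definition creal_comp (a : A) : Type := {eq_quot (cauchyseq_eqv a)}.
HB.instance Definition _ a := Choice.on (creal_comp a).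
HB.instance Definition _ a := EqQuotient.on (creal_comp a).

Definition creal_class (a : A) (p : cauchyseq) : creal_comp a :=
  \pi_(creal_comp a) p.

Definition creal_res (a : A) (x : creal_comp \top) : creal_comp a :=
  creal_class a (repr x).

Lemma creal_classE a p q :
  creal_class a p = creal_class a q <-> cauchyseq_eqv a p q.
Proof. by split=> [/eqmodP|pq]; last apply/eqmodP. Qed.

Lemma cauchyseq_eqv_le a b p q :
  a <= b -> cauchyseq_eqv b p q -> cauchyseq_eqv a p q.
Proof.
move=> ab /asboolP/ctends0_subP pq; apply/asboolP/ctends0_subP => eps eps0.
have [n0 n0P] := pq _ eps0; exists n0 => n n0n c e f g c0 ca.
by apply: n0P => //; exact: le_trans ca ab.
Qed.

Lemma creal_res_class a p : creal_res a (creal_class \top p) = creal_class a p.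
Proof.
apply/creal_classE; apply: cauchyseq_eqv_le (lex1 a) _.
by apply/creal_classE; rewrite /creal_class reprK.
Qed.

Lemma creal_res_surj a (y : creal_comp a) : exists x, creal_res a x = y.
Proof.
exists (creal_class \top (repr y)).
by rewrite creal_res_class /creal_class reprK.
Qed.

Lemma creal_comp_bot : exists x0 : creal_comp \bot, forall x, x = x0.
Proof.
exists (creal_class \bot (cauchyseq_const 0)) => x; rewrite -[x]reprK.
apply/creal_classE/asboolP/ctends0_subP => eps _.
exists (gconst A 0%N) => n _ c e f g c0; by rewrite lex0 (negbTE c0).
Qed.

Lemma creal_res_top x : creal_res \top x = x.
Proof. by rewrite /creal_res /creal_class reprK. Qed.

Lemma creal_res_consistent a b x y :
  a <= b -> creal_res b x = creal_res b y -> creal_res a x = creal_res a y.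
Proof.
move=> ab /creal_classE xy; apply/creal_classE.
exact: cauchyseq_eqv_le ab xy.
Qed.

Section CrealGlue.
Context (I : Type) (a : I -> A) (aP : partition_of a \top).

Lemma gglue_res (E : Type) b (x : I -> gelt E \top) :
  gglue aP (fun i => gres b (x i)) = gres b (gglue aP x).
Proof.
apply: gelt_eq => c e f c0 ce /=; rewrite lexI => /andP[cb cf].
have [c1 [c10 c1c [i c1i]]] := partition_meets aP c0 (lex1 _).
have [c2 [c20 c2c [g c2g]]] := gelt_meets (x i) c10 (lex1 _).
have cc := le_trans c2c c1c; have ci := le_trans c2c c1i.
rewrite (gglueP (aP := aP) (x := x) c20 ci (le_trans cc cf) c2g).
apply: (gglueP (aP := aP) (x := fun i => gres b (x i)) c20 ci).
  exact: le_trans cc ce.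
by rewrite /= lexI c2g (le_trans cc cb).
Qed.

Definition cseq_glue (p : I -> cseq) : cseq.
Proof.
refine (@CondFun _ _ cnat crat (fun b n => gglue aP (fun i => p i b n)) _).
move=> b n; apply: etrans (gglue_res _ _); congr gglue.
by apply/funext => i; rewrite cfun_res.
Defined.

Lemma cnat_glue_max (n0 : I -> cnat \top) (n : cnat \top) i :
  cnat_le (gglue aP n0) n ->
  res cnat (a i) (cnat_max n (n0 i)) = res cnat (a i) n.
Proof.
move=> /grelP nn; apply/gresP => c k l c0 ci ck cl.
gsplit (n0 i) u hu.
rewrite (gmap2P c0 ck cl hu); apply/maxn_idPl.
by apply: (nn c) => //; exact: gglue_le ci hu.
Qed.

Lemma cseq_local b (p : cseq) (n m : cnat \top) c e :
  res cnat b m = res cnat b n -> c <= b -> c <= gval (p _ n) e ->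
  c <= gval (p _ m) e.
Proof.
move=> mn cb ce.
have /(congr1 (fun x : gelt rat b => gval x e))/= :
    res crat b (p _ m) = res crat b (p _ n) by rewrite -!cfun_res mn.
move=> E; have : c <= b `&` gval (p _ m) e by rewrite E lexI cb.
by move=> /le_trans; apply; rewrite leIr.
Qed.

Lemma cseq_glue_cauchy (p : I -> cseq) :
  (forall i, ccauchy (p i)) -> ccauchy (cseq_glue p).
Proof.
move=> pC eps eps0; have [n0 n0P] := choice (fun i => pC i _ eps0).
exists (gglue aP n0) => m n mM nM.
apply/crat_dist_ltP => c e f g c0 ce cf cg.
have [c1 [c10 c1c [i c1i]]] := partition_meets aP c0 (lex1 _).
move: ce cf cg => /(le_trans c1c) ce /(le_trans c1c) cf /(le_trans c1c) cg.
move: c1i; clear c1c c0 c; rename c1 into c, c10 into c0 => ci.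
gsplit (p i _ n) u hu; gsplit (p i _ m) v hv.
rewrite (gglueP c0 ci ce hu) (gglueP c0 ci cf hv).
have /crat_dist_ltP := n0P i _ _ (cnat_le_maxr m (n0 i)) (cnat_le_maxr n (n0 i)).
apply; [exact: c0| | |exact: cg].
  exact: cseq_local (cnat_glue_max i nM) ci hu.
exact: cseq_local (cnat_glue_max i mM) ci hv.
Qed.

Definition cauchyseq_glue (p : I -> cauchyseq) : cauchyseq :=
  CauchySeq (cseq_glue_cauchy (fun i => cauchyseqP (p i))).

Lemma cauchyseq_glue_eqv (p : I -> cauchyseq) i :
  cauchyseq_eqv (a i) (cauchyseq_glue p) (p i).
Proof.
apply/asboolP/ctends0_subP => eps /crat_gt0P eps0.
exists (gconst A 0%N) => n _ c e f g c0 ci ce cf cg.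
by rewrite (gglueP c0 ci ce cf) subrr normr0; exact: eps0 cg.
Qed.

Lemma cauchyseq_eqv_glue p q :
  (forall i, cauchyseq_eqv (a i) p q) -> cauchyseq_eqv \top p q.
Proof.
move=> H; apply/asboolP/ctends0_subP => eps eps0.
have {}H i : ctends0 (a i) (cseq_sub p q) by move: (H i) => /asboolP.
have [n0 n0P] := choice (fun i => (ctends0_subP _ _ _).1 (H i) _ eps0).
exists (gglue aP n0) => n nM c e f g c0 _ ce cf cg.
have [c1 [c10 c1c [i c1i]]] := partition_meets aP c0 (lex1 _).
apply: (n0P i _ (cnat_le_maxr n (n0 i)) c1) => //.
- exact: cseq_local (cnat_glue_max i nM) c1i (le_trans c1c ce).
- exact: cseq_local (cnat_glue_max i nM) c1i (le_trans c1c cf).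
- exact: le_trans c1c cg.
Qed.

Lemma creal_res_stable (x : I -> creal_comp \top) :
  exists! y, forall i, creal_res (a i) y = creal_res (a i) (x i).
Proof.
exists (creal_class \top (cauchyseq_glue (fun i => repr (x i)))).
split=> [i|y yx].
  by rewrite creal_res_class; apply/creal_classE; exact: cauchyseq_glue_eqv.
rewrite -[y in RHS]creal_res_top; apply/creal_classE.
apply: cauchyseq_eqv_glue => i; apply: cauchyseq_eqv_trans (cauchyseq_glue_eqv _ i) _.
by rewrite cauchyseq_eqv_sym; apply/creal_classE; exact: yx.
Qed.

End CrealGlue.

Definition creal : condset A :=
  CondSet creal_res_surj creal_comp_bot creal_res_top creal_res_consistent
    (fun _ _ x aP => creal_res_stable aP x).

Definition creal_zero : creal \top := creal_class \top (cauchyseq_const 0).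

Definition creal_add (x y : creal \top) : creal \top :=
  creal_class \top (cauchyseq_add (repr x) (repr y)).

Definition creal_sub (x y : creal \top) : creal \top :=
  creal_class \top (cauchyseq_sub (repr x) (repr y)).

Definition creal_mul (x y : creal \top) : creal \top :=
  creal_class \top (cauchyseq_mul (repr x) (repr y)).

Definition creal_abs (x : creal \top) : creal \top :=
  creal_class \top (cauchyseq_abs (repr x)).

Definition creal_le (x y : creal \top) : Prop :=
  forall eps, crat_lt (cratc 0) eps ->
    exists n0 : cnat \top, forall n : cnat \top, cnat_le n0 n ->
      crat_lt (crat_opp eps) (crat_sub (repr y _ n) (repr x _ n)).

Definition creal_lt : creal \top -> creal \top -> Prop := clt creal_le.

Definition creal_ball (x eps : creal \top) : cfamily creal :=
  cgen [set y : creal \top | creal_lt (creal_abs (creal_sub x y)) eps]%classic.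

Definition creal_open : set (cfamily creal) :=
  ctopology_generated
    [set V | exists x eps : creal \top, creal_lt creal_zero eps /\ V = creal_ball x eps]%classic.

End ConditionalReals.

Arguments creal_open {d} A.

Section EssentialUnion.
Local Open Scope ring_scope.
Local Open Scope classical_set_scope.
Local Open Scope ereal_scope.
Context (d : measure_display) (T : measurableType d) (R : realType).
Implicit Types (F : set (set T)) (A : nat -> set T).

Definition countable_subfamily F A := forall k, F (A k) \/ A k = set0.

Lemma countable_subfamily_merge F (A : nat -> nat -> set T) :
  (forall j, countable_subfamily F (A j)) ->
  exists2 B, countable_subfamily F B & \bigcup_k B k = \bigcup_j \bigcup_k A j k.
Proof.
move=> FA; exists (fun n => if unpickle n is Some jk
                     then A (jk : nat * nat).1 jk.2 else set0).
  by move=> n; case: unpickle => [[j k]|]; [exact: FA|right].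
apply/seteqP; split=> [x [n _]|x [j _ [k _ xA]]].
  by case: unpickle => // -[j k] /= xA; exists j => //; exists k.
by exists (pickle (j, k)) => //; rewrite pickleK.
Qed.

Context (mu : {sigma_finite_measure set T -> \bar R}).

Lemma countable_subfamily_measurable F A : F `<=` measurable ->
  countable_subfamily F A -> measurable (\bigcup_k A k).
Proof. by move=> mF FA; apply: bigcupT_measurable => k; case: (FA k) => [/mF|->]. Qed.

Lemma essential_union_fin F (G : set T) : F `<=` measurable ->
  measurable G -> mu G < +oo ->
  exists2 A, countable_subfamily F A &
    forall B, F B -> mu (G `&` B `\` \bigcup_k A k) = 0.
Proof.
move=> mF mG Goo.
pose v A := mu (G `&` \bigcup_k A k).
pose S := [set v A | A in [set A | countable_subfamily F A]].
have mU := countable_subfamily_measurable mF.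
have S0 : S != set0.
  by apply/set0P; exists (v (fun=> set0)), (fun=> set0) => // k; right.
have [u uS ucvg] := ereal_sup_seq S0.
have /choice[B /all_and2[BF vB]] : forall j, exists A, countable_subfamily F A /\ v A = u j.
  by move=> j; have [A FA <-] := uS j; exists A.
have [A FA AE] := countable_subfamily_merge BF.
have vsup A' : countable_subfamily F A' -> v A' <= v A.
  move=> FA'; apply: (@le_trans _ _ (ereal_sup S)).
    by apply: ereal_sup_ubound; exists A'.
  rewrite -(cvg_lim _ ucvg) //; apply: lime_le; first by apply/cvg_ex; exists (ereal_sup S).
  apply: nearW => j; rewrite -vB; apply: le_measure; rewrite ?inE.
  - exact: measurableI (mU _ (BF j)).
  - exact: measurableI (mU _ FA).
  - by apply: setIS; rewrite AE => x Bx; exists j.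
exists A => // C FC.
pose A' n := if n is n'.+1 then A n' else C.
have FA' : countable_subfamily F A' by case=> [|n]; [left|exact: FA].
have A'E : \bigcup_k A' k = C `|` \bigcup_k A k.
  apply/seteqP; split=> [x [[|n] _ xA]|x [xC|[n _ xA]]].
  - by left.
  - by right; exists n.
  - by exists 0%N.
  - by exists n.+1.
have mC := mF _ FC; have mUA := mU _ FA.
have := vsup _ FA'; rewrite /v A'E.
have -> : G `&` (C `|` \bigcup_k A k) =
    (G `&` \bigcup_k A k) `|` (G `&` C `\` \bigcup_k A k).
  apply/seteqP; split=> [x [Gx [Cx|Ux]]|x [[Gx Ux]|[[Gx Cx] _]]].
  - by have [Ux|Ux] := pselect ((\bigcup_k A k) x); [left|right].
  - by left.
  - by split => //; right.
  - by split => //; left.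
rewrite measureU //; first last.
- by apply/seteqP; split=> x // -[[_ Ux] [_ nUx]].
- by apply: measurableD => //; exact: measurableI.
- exact: measurableI.
have fin : mu (G `&` \bigcup_k A k) \is a fin_num.
  rewrite ge0_fin_numE //; apply: le_lt_trans Goo.
  by apply: le_measure; rewrite ?inE //; exact: measurableI.
rewrite -leeBrDl // subee // => le0.
by apply/eqP; rewrite eq_le le0 measure_ge0.
Qed.

Lemma essential_union F : F `<=` measurable ->
  exists2 A, countable_subfamily F A &
    forall B, F B -> mu (B `\` \bigcup_k A k) = 0.
Proof.
move=> mF; have [G GT /all_and2[mG Goo]] := sigma_finiteT mu.
have /choice[A0 /all_and2[FA0 A0P]] : forall j, exists A, countable_subfamily F A /\
    forall B, F B -> mu (G j `&` B `\` \bigcup_k A k) = 0.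
  by move=> j; have [A FA AP] := essential_union_fin mF (mG j) (Goo j); exists A.
have [A FA AE] := countable_subfamily_merge FA0.
exists A => // B FB; have mB := mF _ FB.
have mUA := countable_subfamily_measurable mF FA.
apply: measure_negligible; first exact: measurableD.
apply: (negligibleS (A := \bigcup_j (G j `&` B `\` \bigcup_k A0 j k))).
  move=> x [Bx nUx]; have : [set: T] x by [].
  rewrite GT => -[j _ Gjx]; exists j => //; split => //.
  by rewrite AE in nUx => Ux; apply: nUx; exists j.
apply: negligible_bigcup => j; apply/negligibleP; last exact: A0P.
apply: measurableD; first exact: measurableI.
exact: countable_subfamily_measurable mF (FA0 j).
Qed.

End EssentialUnion.

Section MeasureAlgebra.
Local Open Scope ring_scope.
Local Open Scope classical_set_scope.
Context (d : measure_display) (T : measurableType d) (R : realType).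

Record mset := MSet {
  mset_val :> set T;
  msetP : measurable mset_val
}.
HB.instance Definition _ := gen_eqMixin mset.
HB.instance Definition _ := gen_choiceMixin mset.

Lemma mset_inj (B C : mset) : B = C :> set T -> B = C.
Proof.
case: B => B mB; case: C => C mC /= BC; case: C / BC mC => mC.
by congr MSet; exact: Prop_irrelevance.
Qed.

Definition mset0 := MSet (@measurable0 _ T).
Definition msetT := MSet (@measurableT _ T).
Definition msetI (B C : mset) := MSet (measurableI _ _ (msetP B) (msetP C)).
Definition msetU (B C : mset) := MSet (measurableU _ _ (msetP B) (msetP C)).
Definition msetC (B : mset) := MSet (measurableC (msetP B)).
Definition mset_bigcup (B : nat -> mset) :=
  MSet (bigcupT_measurable _ (fun k => msetP (B k))).

Context (mu : {sigma_finite_measure set T -> \bar R}).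

Definition mset_eqv : rel mset := fun B C => mu (B `+` C) == 0%E.

Lemma mset_eqvP (B C : mset) :
  reflect (\forall x \ae mu, mset_val B x <-> mset_val C x) (mset_eqv B C).
Proof.
have mY : measurable (B `+` C).
  by apply: measurableU; apply: measurableD; exact: msetP.
have E : ~` [set x | mset_val B x <-> mset_val C x] = B `+` C.
  apply/seteqP; split=> [x /= nBC|x [[Bx nCx]|[Cx nBx]]] /=; last 2 first.
  - by move=> [/(_ Bx)].
  - by move=> [_ /(_ Cx)].
  have [Bx|nBx] := pselect (mset_val B x); have [Cx|nCx] := pselect (mset_val C x).
  - by exfalso; apply: nBC.
  - by left.
  - by right.
  - by exfalso; apply: nBC.
apply: (iffP eqP) => [/(negligibleP _ mY)|].
  by rewrite -E.
by move=> H; apply: measure_negligible => //; rewrite -E.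
Qed.

Lemma mset_eqv_refl : reflexive mset_eqv.
Proof. by move=> B; apply/mset_eqvP/aeW. Qed.

Lemma mset_eqv_sym : symmetric mset_eqv.
Proof. by move=> B C; rewrite /mset_eqv setYC. Qed.

Lemma mset_eqv_trans : transitive mset_eqv.
Proof.
move=> C B D /mset_eqvP BC /mset_eqvP CD; apply/mset_eqvP.
by apply: filterS2 BC CD => x -> ->.
Qed.

Canonical mset_equiv := EquivRel mset_eqv
  mset_eqv_refl mset_eqv_sym mset_eqv_trans.

Local Open Scope quotient_scope.

Definition measalg : Type := {eq_quot mset_eqv}.
HB.instance Definition _ := Choice.on measalg.
HB.instance Definition _ := EqQuotient.on measalg.

Definition mclass (B : mset) : measalg := \pi_measalg B.

Lemma mclassP (B C : mset) : mclass B = mclass C <->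
  \forall x \ae mu, mset_val B x <-> mset_val C x.
Proof. by split=> [/eqmodP/mset_eqvP|/mset_eqvP BC]; last exact/eqmodP. Qed.

Lemma repr_mclass (B : mset) : \forall x \ae mu, mset_val (repr (mclass B)) x <-> mset_val B x.
Proof. by apply/mclassP; rewrite /mclass reprK. Qed.

Lemma mclass_repr (b : measalg) : mclass (repr b) = b.
Proof. exact: reprK. Qed.

Definition measalg_meet (b c : measalg) := mclass (msetI (repr b) (repr c)).
Definition measalg_join (b c : measalg) := mclass (msetU (repr b) (repr c)).
Definition measalg_compl (b : measalg) := mclass (msetC (repr b)).
Definition measalg_le (b c : measalg) := measalg_meet b c == b.
Definition measalg_lt (b c : measalg) := (c != b) && measalg_le b c.

Lemma measalg_meetE B C : measalg_meet (mclass B) (mclass C) = mclass (msetI B C).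
Proof.
apply/mclassP; apply: filterS2 (repr_mclass B) (repr_mclass C) => x BE CE.
by split=> -[/BE ? /CE ?].
Qed.

Lemma measalg_joinE B C : measalg_join (mclass B) (mclass C) = mclass (msetU B C).
Proof.
apply/mclassP; apply: filterS2 (repr_mclass B) (repr_mclass C) => x BE CE.
by split=> -[/BE|/CE] ?; by [left|right].
Qed.

Lemma measalg_complE B : measalg_compl (mclass B) = mclass (msetC B).
Proof.
apply/mclassP; apply: filterS (repr_mclass B) => x BE.
by split=> nB /BE.
Qed.

Lemma measalg_leE B C : measalg_le (mclass B) (mclass C) <->
  \forall x \ae mu, mset_val B x -> mset_val C x.
Proof.
rewrite /measalg_le measalg_meetE; split=> [/eqP/mclassP|H].
  by apply: filterS => x BC /BC[].
by apply/eqP/mclassP; apply: filterS H => x BC; split=> [[]|Bx] //; split=> //; exact: BC.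
Qed.

Lemma measalg_ind (P : measalg -> Prop) :
  (forall B, P (mclass B)) -> forall b, P b.
Proof. by move=> H b; rewrite -[b]mclass_repr. Qed.

Ltac measalg_set :=
  do ?[elim/measalg_ind => ?];
  rewrite /= ?(measalg_meetE, measalg_joinE, measalg_complE);
  rewrite ?(measalg_meetE, measalg_joinE, measalg_complE);
  congr mclass; apply: mset_inj => /=.

Lemma measalg_meetC : commutative measalg_meet.
Proof. by measalg_set; rewrite setIC. Qed.
Lemma measalg_joinC : commutative measalg_join.
Proof. by measalg_set; rewrite setUC. Qed.
Lemma measalg_meetA : associative measalg_meet.
Proof. by measalg_set; rewrite setIA. Qed.
Lemma measalg_joinA : associative measalg_join.
Proof. by measalg_set; rewrite setUA. Qed.
Lemma measalg_joinKI y x : measalg_meet x (measalg_join x y) = x.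
Proof. by move: x y; measalg_set; rewrite setUC setKU. Qed.
Lemma measalg_meetKU y x : measalg_join x (measalg_meet x y) = x.
Proof. by move: x y; measalg_set; rewrite setIC setKI. Qed.
Lemma measalg_meetUl : left_distributive measalg_meet measalg_join.
Proof. by measalg_set; rewrite setIUl. Qed.
Lemma measalg_meetxx : idempotent_op measalg_meet.
Proof. by measalg_set; rewrite setIid. Qed.

Fact measalg_display : Order.disp_t. Proof. exact: (Order.Disp tt tt). Qed.

HB.instance Definition _ := Order.isMeetJoinDistrLattice.Build measalg_display
  measalg (fun _ _ => erefl) (fun _ _ => erefl) measalg_meetC measalg_joinC
  measalg_meetA measalg_joinA measalg_joinKI measalg_meetKU measalg_meetUl
  measalg_meetxx.

Lemma measalg_le0x (b : measalg) : (mclass mset0 <= b)%O.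
Proof. by elim/measalg_ind: b => B; apply/measalg_leE/aeW. Qed.

Lemma measalg_lex1 (b : measalg) : (b <= mclass msetT)%O.
Proof. by elim/measalg_ind: b => B; apply/measalg_leE/aeW. Qed.

HB.instance Definition _ := Order.hasBottom.Build measalg_display measalg
  measalg_le0x.
HB.instance Definition _ := Order.hasTop.Build measalg_display measalg
  measalg_lex1.

Lemma measalg_joinxC (b : measalg) :
  measalg_join b (measalg_compl b) = mclass msetT.
Proof. by move: b; measalg_set; rewrite setUv. Qed.

Lemma measalg_meetxC (b : measalg) :
  measalg_meet b (measalg_compl b) = mclass mset0.
Proof. by move: b; measalg_set; rewrite setICr. Qed.

HB.instance Definition _ := Order.TBDistrLattice_hasComplement.Build
  measalg_display measalg measalg_joinxC measalg_meetxC.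

Lemma measalg_join_exists (S : set measalg) : {B : mset |
  (forall b, S b -> (b <= mclass B)%O) /\
  (forall c, (forall b, S b -> (b <= c)%O) -> (mclass B <= c)%O)}.
Proof.
apply: cid; pose F := [set B | exists2 C : mset, S (mclass C) & B = C :> set T].
have mF : F `<=` measurable by move=> _ [C _ ->]; exact: msetP.
have [A FA AP] := essential_union mu mF.
have mA k : measurable (A k) by case: (FA k) => [/mF|->].
exists (mset_bigcup (fun k => MSet (mA k))); split.
  elim/measalg_ind => B SB; apply/measalg_leE => /=.
  have /AP/(negligibleP _ (measurableD (msetP B) _)) : F B by exists B.
  move=> /(_ (bigcupT_measurable _ mA)) H.
  by apply: negligibleS H => x /= /not_implyP.
elim/measalg_ind => C CS; apply/measalg_leE => /=.
have : \forall x \ae mu, forall k, A k x -> mset_val C x.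
  apply: ae_foralln => k; case: (FA k) => [[B SB BE]|->]; last exact: aeW.
  by rewrite BE; apply/measalg_leE; exact: CS.
by apply: filterS => x H [k _]; exact: H.
Qed.

Definition measalg_bigjoin (S : set measalg) : measalg :=
  mclass (projT1 (measalg_join_exists S)).

Lemma measalg_bigjoin_ub (S : set measalg) b : S b ->
  (b <= measalg_bigjoin S)%O.
Proof. exact: (projT2 (measalg_join_exists S)).1. Qed.

Lemma measalg_bigjoin_le (S : set measalg) c :
  (forall b, S b -> (b <= c)%O) -> (measalg_bigjoin S <= c)%O.
Proof. exact: (projT2 (measalg_join_exists S)).2. Qed.

HB.instance Definition _ := hasArbitraryJoins.Build measalg_display measalg
  measalg_bigjoin_ub measalg_bigjoin_le.

End MeasureAlgebra.

Section ConditionalL0.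
Local Open Scope ring_scope.
Local Open Scope classical_set_scope.
Context (d : measure_display) (T : measurableType d) (R : realType).
Context (mu : {sigma_finite_measure set T -> \bar R}).
Local Notation measalg := (measalg mu).
Local Notation L0 := {mfun_ mu, T >-> R}.
Implicit Types (a b : measalg) (f g h : L0) (u v : {mfun T >-> R}).

Local Open Scope quotient_scope.

Definition L0_class u : L0 := \pi_L0 u.

Definition L0_add f g : L0 := L0_class (repr f + repr g).
Definition L0_mul f g : L0 := L0_class (repr f * repr g).
Definition L0_le f g : Prop := \forall x \ae mu, f x <= g x.

(* [1_A f], with [A] the chosen representative of [a] *)
Definition L0_restr a f : L0 := L0_class (indic_mfun _ (msetP (repr a)) * repr f).

Lemma L0_classP u v : L0_class u = L0_class v <-> \forall x \ae mu, u x = v x.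
Proof.
split=> [/eqmodP/asboolP|H]; first by apply: filterS => x; exact.
by apply/eqmodP/asboolP; apply: filterS H.
Qed.

Lemma L0_classE u : \forall x \ae mu, L0_class u x = u x.
Proof. by apply/L0_classP; rewrite /L0_class reprK. Qed.

Lemma L0_eqP f g : f = g <-> \forall x \ae mu, f x = g x.
Proof.
split=> [->|H]; first exact: aeW.
by rewrite -[f]reprK -[g]reprK; exact/L0_classP.
Qed.

Lemma L0_restrE a f :
  \forall x \ae mu, L0_restr a f x = \1_(mset_val (repr a)) x * f x.
Proof. exact: L0_classE. Qed.

Lemma L0_restrP a f g : L0_restr a f = L0_restr a g <->
  \forall x \ae mu, mset_val (repr a) x -> f x = g x.
Proof.
rewrite L0_eqP; split=> H.
  apply: filterS3 (L0_restrE a f) (L0_restrE a g) H => x -> -> + ax.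
  by rewrite indicE mem_set // !mul1r.
apply: filterS3 (L0_restrE a f) (L0_restrE a g) H => x -> -> H.
rewrite !indicE; case: (asboolP (mset_val (repr a) x)) => ax.
  by rewrite mem_set // !mul1r H.
by rewrite memNset // !mul0r.
Qed.

Lemma measalg_repr_le a b : (a <= b)%O ->
  \forall x \ae mu, mset_val (repr a) x -> mset_val (repr b) x.
Proof.
by rewrite -{1}[a]mclass_repr -{1}[b]mclass_repr => ab; apply/measalg_leE.
Qed.

Lemma measalg_repr_top :
  \forall x \ae mu, mset_val (repr (\top%O : measalg)) x.
Proof. by have := repr_mclass mu (msetT T); apply: filterS => x H; exact/H. Qed.

Lemma measalg_repr_bot :
  \forall x \ae mu, ~ mset_val (repr (\bot%O : measalg)) x.
Proof. by have := repr_mclass mu (mset0 T); apply: filterS => x H /H. Qed.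

Record L0_comp (a : measalg) := L0Comp {
  L0_val :> L0;
  L0_compP : exists f, L0_val = L0_restr a f
}.

Lemma L0_val_inj a (x y : L0_comp a) : x = y :> L0 -> x = y.
Proof.
case: x => f fP; case: y => g gP /= fg; case: g / fg gP => gP.
by congr L0Comp; exact: Prop_irrelevance.
Qed.

Definition L0_mk a f : L0_comp a :=
  L0Comp (ex_intro (fun g => L0_restr a f = L0_restr a g) f erefl).

Definition L0_res a (x : L0_comp \top%O) : L0_comp a := L0_mk a x.

Lemma L0_restr_top f : L0_restr \top%O f = f.
Proof.
apply/L0_eqP; apply: filterS2 (L0_restrE \top%O f) measalg_repr_top => x -> tx.
by rewrite indicE mem_set // mul1r.
Qed.

Lemma L0_res_surj a (y : L0_comp a) : exists x, L0_res a x = y.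
Proof.
case: y => g [f gE]; exists (L0_mk \top%O f); apply: L0_val_inj => /=.
by rewrite L0_restr_top gE.
Qed.

Lemma L0_comp_bot : exists x0 : L0_comp \bot%O, forall x, x = x0.
Proof.
exists (L0_mk \bot%O (L0_class 0)) => -[g [f gE]]; apply: L0_val_inj => /=.
rewrite gE; apply/L0_restrP.
by apply: filterS measalg_repr_bot => x nx /nx.
Qed.

Lemma L0_res_top (x : L0_comp \top%O) : L0_res \top%O x = x.
Proof. by apply: L0_val_inj; rewrite /= L0_restr_top. Qed.

Lemma L0_resP a (x y : L0_comp \top%O) : L0_res a x = L0_res a y <->
  \forall t \ae mu, mset_val (repr a) t -> x t = y t.
Proof.
by split=> [/(congr1 (@L0_val a))/L0_restrP//|H]; apply/L0_val_inj/L0_restrP.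
Qed.

Lemma L0_res_consistent a b x y :
  (a <= b)%O -> L0_res b x = L0_res b y -> L0_res a x = L0_res a y.
Proof.
move=> /measalg_repr_le ab /L0_resP xy; apply/L0_resP.
by apply: filterS2 ab xy => t ab xy /ab.
Qed.

(* Measurable functions [u k] glued along the sets [A k], the least [k] wins *)
Lemma mfun_glue (A : nat -> set T) (u : nat -> {mfun T >-> R}) :
  (forall k, measurable (A k)) ->
  exists v : {mfun T >-> R}, forall t, (\bigcup_k A k) t ->
    exists2 k, A k t & v t = u k t.
Proof.
move=> mA; pose E := seqDU A.
have mE k : measurable (E k).
  by apply: measurableD => //; apply: bigsetU_measurable.
pose idx t := get [set k | E k t].
have idxE k t : E k t -> idx t = k.
  move=> Ekt; rewrite /idx; case: xgetP => [l _ Elt|/(_ k)//].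
  have /trivIsetP/(_ l k I I) := trivIset_seqDU A.
  have [//|lk /(_ isT) H] := eqVneq l k.
  by exfalso; have : (E l `&` E k) t by []; rewrite H.
pose w t := if pselect ((\bigcup_k A k) t) then u (idx t) t else 0.
have mw : measurable_fun setT w.
  have -> : [set: T] = (\bigcup_k E k) `|` ~` (\bigcup_k A k).
    by rewrite -seqDU_bigcup_eq setUv.
  have mUA : measurable (\bigcup_k A k) by exact: bigcupT_measurable.
  apply/measurable_funU; [exact: bigcupT_measurable|exact: measurableC|].
  split.
    apply/measurable_fun_bigcup => // k.
    apply: (eq_measurable_fun (u k)); last by apply: measurable_funTS; exact: measurable_funP.
    move=> t /set_mem Ekt; rewrite /w (idxE _ _ Ekt); case: pselect => // nA.
    by exfalso; apply: nA; rewrite seqDU_bigcup_eq; exists k.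
  apply: (eq_measurable_fun (cst (0 : R))); last exact: measurable_cst.
  by move=> t /set_mem nA; rewrite /w; case: pselect.
have wP : w \in mfun by rewrite inE.
exists (mfun_Sub wP : {mfun T >-> R}) => t UA.
have -> : mfun_Sub wP t = u (idx t) t.
  by rewrite /= /w; case: pselect.
move: UA; rewrite seqDU_bigcup_eq => -[k _ Ekt]; exists k; last by rewrite (idxE _ _ Ekt).
by case: Ekt.
Qed.

Lemma L0_res_stable (I : Type) (a : I -> measalg) (x : I -> L0_comp \top%O) :
  partition_of a \top%O ->
  exists! y, forall i, L0_res (a i) y = L0_res (a i) (x i).
Proof.
move=> aP; pose F := [set B | exists i, B = mset_val (repr (a i))].
have mF : F `<=` measurable by move=> _ [i ->]; exact: msetP.
have [A FA AP] := essential_union mu mF.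
have mA k : measurable (A k) by case: (FA k) => [/mF|->].
have dis i j : i <> j -> \forall t \ae mu,
    mset_val (repr (a i)) t -> ~ mset_val (repr (a j)) t.
  move=> /aP.1; rewrite -{1}[a i]mclass_repr -{1}[a j]mclass_repr => E.
  have /mclassP : mclass mu (msetI (repr (a i)) (repr (a j))) = mclass mu (mset0 T).
    by rewrite -measalg_meetE.
  by apply: filterS => t [H _] ai aj; apply: H.
have /choice[u uP] k : exists u : {mfun T >-> R}, forall i, \forall t \ae mu,
    mset_val (repr (a i)) t -> A k t -> u t = x i t.
  case: (FA k) => [[j ->]|->]; last by exists 0 => i; apply: aeW => t _ [].
  exists (repr (x j : L0)) => i.
  have [<-|ij] := pselect (i = j); first exact: aeW.
  by apply: filterS (dis _ _ ij) => t H ai aj; exfalso; exact: (H ai).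
have [v vP] := mfun_glue u mA.
have cov : forall i, \forall t \ae mu, mset_val (repr (a i)) t -> (\bigcup_k A k) t.
  move=> i; have /(negligibleP _ (measurableD (msetP _) _)) :
    mu (mset_val (repr (a i)) `\` \bigcup_k A k) = 0%E by apply: AP; exists i.
  move=> /(_ (bigcupT_measurable _ mA)) H.
  by apply: negligibleS H => t /= /not_implyP.
exists (L0_mk \top%O (L0_class v)); split=> [i|y yx].
  apply/L0_resP => /=; rewrite L0_restr_top.
  have := ae_foralln (fun k => uP k i).
  apply: filterS3 (cov i) (L0_classE v) => t ct -> ut ait.
  by have [k Ak ->] := vP _ (ct ait); exact: ut.
have mD : measurable [set t | L0_class v t = y t].
  have -> : [set t | L0_class v t = y t] =
      (fun t => L0_class v t == y t) @^-1` [set true].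
    by apply/seteqP; split=> t /= /eqP.
  rewrite -[X in measurable X]setTI.
  by apply: (measurable_fun_eqr (measurable_funP _) (measurable_funP _)).
apply: L0_val_inj => /=; rewrite L0_restr_top; apply/L0_eqP.
suff : (\top <= mclass mu (MSet mD))%O.
  by move/measalg_leE; apply: filterS => t H; exact: H.
suff : (bigjoin (range a) <= mclass mu (MSet mD))%O by rewrite aP.2.
apply: bigjoin_le => _ [i _ <-].
rewrite -[a i]mclass_repr; apply/measalg_leE => /=.
have /L0_resP yxi := yx i.
have := ae_foralln (fun k => uP k i).
apply: filterS3 (filterI (cov i) (L0_classE v)) yxi => t [ct /= ->] yt ut ait.
rewrite yt //.
by have [k Ak ->] := vP _ (ct ait); exact: ut.
Qed.

End ConditionalL0.

Section L0ConditionalSet.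
Local Open Scope ring_scope.
Local Open Scope classical_set_scope.
Context (d : measure_display) (T : measurableType d) (R : realType).
Context (mu : {sigma_finite_measure set T -> \bar R}).

Definition condL0 : condset (measalg mu) :=
  CondSet (@L0_res_surj _ _ _ mu) (@L0_comp_bot _ _ _ mu)
    (@L0_res_top _ _ _ mu) (@L0_res_consistent _ _ _ mu)
    (fun _ _ x aP => @L0_res_stable _ _ _ mu _ _ x aP).

Definition condL0_val (g : condL0 \top%O) : {mfun_ mu, T >-> R} := L0_val g.

Definition L0_ball (f eps : {mfun_ mu, T >-> R}) : cfamily condL0 :=
  cgen [set g : condL0 \top%O |
    \forall t \ae mu, `|f t - condL0_val g t| < eps t].

Definition L0_open : set (cfamily condL0) :=
  ctopology_generated
    [set V | exists f eps : {mfun_ mu, T >-> R},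
       (\forall t \ae mu, 0 < eps t) /\ V = L0_ball f eps].

End L0ConditionalSet.
Arguments L0_open {d T R} mu.

(* Main.v *)
Require Import Defs.
From mathcomp Require Import all_boot all_order all_algebra.
From mathcomp Require Import all_classical all_reals all_analysis.
From mathcomp Require Import measurable_realfun.
From mathcomp Require Import lra.

Set Implicit Arguments.
Unset Strict Implicit.
Unset Printing Implicit Defensive.

Import Order.Theory GRing.Theory Num.Theory numFieldNormedType.Exports.

Local Open Scope ring_scope.
Local Open Scope quotient_scope.
Local Open Scope classical_set_scope.

(** Elements of $\mathcal A$ are events modulo null sets, so a conditional natural or rational is,
    almost everywhere, a measurable function with countably many values. As only countably many
    pairs of values occur, what holds on all nonzero conditions is exactly what holds at almost
    every point ([forcing_atP]).

    A conditional sequence is determined almost everywhere by its terms at constant indices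
    ([cseq_valE]). A conditional threshold $n_0$ is a measurable threshold function, and pointwise
    thresholds can be chosen measurably by taking the least one; hence a single conditional $n_0$
    amounts to a threshold $N$ at almost every point ([cnat_eventually]). By completeness of the
    classical reals, conditionally Cauchy then means convergent almost everywhere ([ccauchy_aeP]).

    The map $\varphi$ sends a class to this pointwise limit. Two sequences are equivalent on $a$ iff
    their limits agree almost everywhere on $a$ ([cauchyseq_eqv_aeP]), which makes $\varphi$ well
    defined and injective at every level. For surjectivity, rationals within $1/(k+1)$ of $f$ are
    selected measurably for each $k$ ([cauchyseq_lim_surj]). Operations and order pass to limits.

    A conditional bijection transports conditional topologies, so continuity need only be tested on
    generating balls ([generated_continuous]), and these correspond to each other under $\varphi$
    ([cpreimage_L0_ball]). *)

Local Notation "t \at a" := (mset_val (repr a) t) (at level 70).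

(** * Conditional elements read almost everywhere, and measurable selection *)

Section AlmostEverywhere.
Context (d : measure_display) (T : measurableType d) (R : realType).
Context (mu : {sigma_finite_measure set T -> \bar R}).
Local Notation A := (measalg mu).
Implicit Types (a b : A).

Lemma ae_forall_count (E : countType) (P : E -> T -> Prop) :
  (forall e, \forall t \ae mu, P e t) -> \forall t \ae mu, forall e, P e t.
Proof.
move=> H.
have : \forall t \ae mu, forall n, if @unpickle E n is Some e then P e t else True.
  by apply: ae_foralln => n; case: unpickle => [e|]; [exact: H|exact: aeW].
by apply: filterS => t Pt e; have := Pt (pickle e); rewrite pickleK.
Qed.

Lemma bigcup_count_measurable (E : countType) (B : E -> set T) :
  (forall e, measurable (B e)) -> measurable (\bigcup_e B e).
Proof. by move=> mB; exact: countable_bigcupT_measurable. Qed.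

Lemma measalg_leP a b : (a <= b)%O <-> \forall t \ae mu, t \at a -> t \at b.
Proof.
split; first exact: measalg_repr_le.
by move=> ab; rewrite -[a]mclass_repr -[b]mclass_repr; exact/measalg_leE.
Qed.

Lemma measalg_at_meet a b :
  \forall t \ae mu, t \at (a `&` b)%O <-> t \at a /\ t \at b.
Proof. exact: repr_mclass mu (msetI (repr a) (repr b)). Qed.

Lemma measalg_eq_bot a : a = \bot%O <-> \forall t \ae mu, ~ t \at a.
Proof.
split=> [->|na]; first exact: measalg_repr_bot.
apply/eqP; rewrite -lex0; apply/measalg_leP.
by apply: filterS na => t nt /nt.
Qed.

(** Countability of [E] makes the union of the representatives measurable; its class bounds every
    piece from above, hence also their join [b]. *)
Lemma partition_cover (E : countType) (x : E -> A) b : partition_of x b ->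
  \forall t \ae mu, t \at b -> exists e, t \at x e.
Proof.
move=> [_ xb].
have mU := bigcup_count_measurable (fun e => msetP (repr (x e))).
have : (b <= mclass mu (MSet mU))%O.
  rewrite -xb; apply: bigjoin_le => _ [e _ <-]; rewrite -[x e]mclass_repr.
  by apply/measalg_leE/aeW => t xt; exists e => //; rewrite mclass_repr in xt *.
rewrite -[X in (X <= _)%O]mclass_repr => /measalg_leE.
by apply: filterS => t bt /bt [e _ xt]; exists e.
Qed.

Section ConditionalElements.
Context (E F G : countType).
Implicit Types (x : gelt (A := A) E \top%O) (y : gelt (A := A) F \top%O).

Lemma gelt_at_ex x : \forall t \ae mu, exists e, t \at x e.
Proof.
apply: filterS2 (measalg_repr_top mu) (partition_cover (gvalP x)) => t tt; exact.
Qed.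

Lemma gconst_at (e : E) :
  \forall t \ae mu, t \at gconst A e e.
Proof.
apply: filterS (measalg_repr_top mu) => t; congr (mset_val (repr _) t).
by rewrite /= /gconst_fun asboolT.
Qed.

Lemma gmap1_at (h : E -> F) x :
  \forall t \ae mu, forall e, t \at x e -> t \at gmap1 h x (h e).
Proof. by apply: ae_forall_count => e; apply/measalg_leP; exact: gmap1_le. Qed.

Lemma gmap2_at (h : E -> F -> G) x y :
  \forall t \ae mu, forall e f, t \at x e -> t \at y f -> t \at gmap2 h x y (h e f).
Proof.
apply: ae_forall_count => e; apply: ae_forall_count => f.
have /measalg_leP := gmap2_le h (leIl (x e) (y f)) (leIr (y f) (x e)).
by apply: filterS2 (measalg_at_meet (x e) (y f)) => t -> H xe yf; exact: H.
Qed.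

(** This translates forcing into measure theory. A nonzero meet of [a], [x e] and [y f] is itself a
    condition forcing [P e f]; a zero meet excludes the pair almost everywhere; and there are
    countably many pairs. Conversely, a nonzero condition is not null, so it cannot avoid the points
    where the almost-everywhere statement holds. *)
Lemma forcing_atP (P : E -> F -> Prop) a x y :
  (forall c e f, c != \bot%O -> (c <= a)%O -> (c <= x e)%O -> (c <= y f)%O -> P e f) <->
  \forall t \ae mu, t \at a -> forall e f, t \at x e -> t \at y f -> P e f.
Proof.
split=> [H|H c e f c0 /measalg_leP ca /measalg_leP cx /measalg_leP cy].
  suff : \forall t \ae mu, forall e f, t \at a -> t \at x e -> t \at y f -> P e f.
    by apply: filterS => t Ht ta e f; exact: Ht.
  apply: ae_forall_count => e; apply: ae_forall_count => f.
  have [c0|c0] := eqVneq (a `&` (x e `&` y f))%O \bot%O.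
    move/measalg_eq_bot: c0; have aI := measalg_at_meet a (x e `&` y f)%O.
    apply: filterS3 aI (measalg_at_meet (x e) (y f)) => t aI xI nt ta tx ty.
    by case: nt; apply/aI; split => //; apply/xI.
  apply: aeW => t _ _ _; apply: H c0 _ _ _; first exact: leIl.
    exact: le_trans (leIr _ _) (leIl _ _).
  exact: le_trans (leIr _ _) (leIr _ _).
apply: contrapT => nP; move/eqP: c0; apply; apply/measalg_eq_bot.
apply: filterS2 (filterI ca cx) (filterI cy H) => t [ta tx] [ty Ht] tc.
by apply: nP; apply: Ht; auto.
Qed.

Lemma grel_atP (r : E -> F -> Prop) x y : Defs.grel r x y <->
  \forall t \ae mu, forall e f, t \at x e -> t \at y f -> r e f.
Proof.
rewrite Defs.grelP; have := forcing_atP r \top%O x y => -[H1 H2].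
split=> H.
  have := H1 (fun c e f c0 _ => H c e f c0).
  by apply: filterS2 (measalg_repr_top mu) => t tt; exact.
move=> c e f c0 ce cf; apply: (H2 _ c e f c0 (lex1 c) ce cf).
by apply: filterS H => t Ht _.
Qed.

(** Replaces a pointwise choice of witness by a conditional element; it later yields both thresholds
    in the naturals and rational approximations. *)
Lemma measurable_selection (P : E -> T -> Prop) :
  (forall e, measurable [set t | P e t]) ->
  (\forall t \ae mu, exists e, P e t) ->
  exists x, \forall t \ae mu, forall e, t \at x e -> P e t.
Proof.
move=> mP exP.
                                                                          
(* [B e] keeps the points where [e] is the first admissible value in the enumeration [pickle]: the
   sets become disjoint and no point is lost. *)
pose B e := [set t | P e t] `\` \bigcup_f [set t | P f t /\ (pickle f < pickle e)%N].
have mB e : measurable (B e).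
  apply: measurableD => //; apply: bigcup_count_measurable => f.
  have [lt|nlt] := boolP (pickle f < pickle e)%N.
    by rewrite (_ : mkset _ = [set t | P f t]) //; apply/seteqP; split=> t //= -[].
  by rewrite (_ : mkset _ = set0) //; apply/seteqP; split=> t //= -[].
pose x e := mclass mu (MSet (mB e)).
have xE : \forall t \ae mu, forall e, t \at x e <-> B e t.
  by apply: ae_forall_count => e; exact: repr_mclass.
have xP : partition_of x \top%O.
  split=> [e f ef|].
    apply/measalg_eq_bot; apply: filterS2 (measalg_at_meet (x e) (x f)) xE => t xI xE.
    move=> /xI[/xE[Pe Be] /xE[Pf Bf]].
    have [lt|lt|/(pcan_inj pickleK)//] := ltngtP (pickle e) (pickle f).
      by apply: Bf; exists e.
    by apply: Be; exists f.
  apply/eqP; rewrite -le1x; apply/measalg_leP.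
  have le e : (x e <= bigjoin (range x))%O by apply: bigjoin_ub; exists e.
  have /ae_forall_count := fun e => (measalg_leP _ _).1 (le e).
  apply: filterS3 xE exP => t xE [e Pe] xle _.
  suff [f /xE/xle//] : exists f, B f t.
  have ex : exists n, `[< exists2 f, P f t & pickle f = n >].
    by exists (pickle e); apply/asboolP; exists e.
  case: (ex_minnP ex) => n /asboolP[f Pf fn] nmin; exists f; split => // -[g _ [Pg]].
  by rewrite fn ltnNge nmin //; apply/asboolP; exists g.
exists (GElt xP); apply: filterS xE => t xE e /xE[].
by [].
Qed.

End ConditionalElements.

End AlmostEverywhere.

(** * Conditional sequences built from a classical sequence of terms *)

Section SequenceOfTerms.
Context (d : Order.disp_t) (A : cboolAlgType d) (q : nat -> @crat d A \top%O).

Lemma gglue_res_eq (a : A) (m n : @cnat d A \top%O) :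
  res cnat a m = res cnat a n ->
  gres a (gglue (gvalP m) q) = gres a (gglue (gvalP n) q).
Proof.
move=> /gresP mn; apply/gresP => c e f c0 ca ce cf.
gsplit m k km; gsplit n l nl.
have kl := mn _ _ _ c0 ca km nl; subst l.
gsplit (q k) g qg.
by rewrite (gglueP c0 km ce qg) (gglueP c0 nl cf qg).
Qed.

(** The extension $\sum a_k k \mapsto \sum a_k q_k$ of a classical sequence to all conditional
    indices. At level [a] the index is lifted to the top by choice; [gglue_res_eq] shows that the
    lift does not matter. *)
Definition cseq_of_terms_fun (a : A) (n : cnat a) : crat a :=
  gres a (gglue (gvalP (projT1 (cid (res_surj n)))) q).

Lemma cseq_of_terms_res a (n : cnat \top%O) :
  cseq_of_terms_fun (res cnat a n) = res crat a (cseq_of_terms_fun n).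
Proof.
rewrite /cseq_of_terms_fun; case: cid => m /= mn; case: cid => m' /= m'n.
rewrite -[gres \top%O _]/(res crat \top%O _) res_top; apply: gglue_res_eq.
exact: etrans mn (congr1 (res cnat a) (etrans (esym m'n) (gres_top m'))).
Qed.

Definition cseq_of_terms : cseq A := CondFun cseq_of_terms_fun cseq_of_terms_res.

Lemma cseq_of_termsE k : cseq_of_terms _ (gconst A k) = q k.
Proof.
rewrite /= /cseq_of_terms_fun; case: cid => m /=; rewrite !gres_top => ->.
apply: gelt_eq => c e f c0 ce cf; apply: gglueP c0 _ ce cf.
by rewrite /= /gconst_fun asboolT // lex1.
Qed.

End SequenceOfTerms.

(** * Values of conditional rationals; conditional Cauchyness as pointwise convergence *)

Section Values.
Context (d : measure_display) (T : measurableType d) (R : realType).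
Context (mu : {sigma_finite_measure set T -> \bar R}).
Local Notation A := (measalg mu).
Local Notation cnat := (@cnat _ A).
Local Notation crat := (@crat _ A).
Local Notation L0 := {mfun_ mu, T >-> R}.
Implicit Types (a b : A) (x y eps : crat \top%O) (n : cnat \top%O).

(** Stability of $L^0$ glues the constant functions [ratr e] along the pieces of [x]. *)
Lemma crat_val_ex x : exists v : {mfun T >-> R},
  \forall t \ae mu, forall e, t \at gval x e -> v t = ratr e.
Proof.
have [y [yP _]] := L0_res_stable
  (fun e : rat => L0_mk \top%O (L0_class mu (cst (ratr e : R)))) (gvalP x).
exists (repr (L0_val y)); apply: ae_forall_count => e.
have /L0_resP := yP e; rewrite /= L0_restr_top.
by apply: filterS2 (L0_classE mu (cst (ratr e : R))) => t -> H /H.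
Qed.

Definition crat_val x : {mfun T >-> R} := projT1 (cid (crat_val_ex x)).

Lemma crat_valE x :
  \forall t \ae mu, forall e, t \at gval x e -> crat_val x t = ratr e.
Proof. by rewrite /crat_val; case: cid. Qed.

Lemma crat_val_ae x :
  \forall t \ae mu, exists2 e, t \at gval x e & crat_val x t = ratr e.
Proof.
by apply: filterS2 (gelt_at_ex x) (crat_valE x) => t [e te] H; exists e => //; exact: H.
Qed.

Lemma crat_val_map1 (h : rat -> rat) (H : R -> R) x :
  (forall e, ratr (h e) = H (ratr e)) ->
  \forall t \ae mu, crat_val (gmap1 h x) t = H (crat_val x t).
Proof.
move=> hH.
apply: filterS3 (crat_val_ae x) (gmap1_at h x) (crat_valE (gmap1 h x)).
by move=> t [e te ->] hx /(_ _ (hx _ te)) ->.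
Qed.

Lemma crat_val_map2 (h : rat -> rat -> rat) (H : R -> R -> R) x y :
  (forall e f, ratr (h e f) = H (ratr e) (ratr f)) ->
  \forall t \ae mu, crat_val (gmap2 h x y) t = H (crat_val x t) (crat_val y t).
Proof.
move=> hH.
apply: filterS3 (filterI (crat_val_ae x) (crat_val_ae y)) (gmap2_at h x y)
  (crat_valE (gmap2 h x y)).
by move=> t [[e te ->] [f tf ->]] hx /(_ _ (hx _ _ te tf)) ->.
Qed.

Lemma crat_val_const (e : rat) : \forall t \ae mu, crat_val (cratc e) t = ratr e.
Proof. by apply: filterS2 (crat_valE (cratc e)) (gconst_at mu e) => t H /H. Qed.

Lemma crat_lt_res_aeP a x y : crat_lt (res crat a x) (res crat a y) <->
  \forall t \ae mu, t \at a -> crat_val x t < crat_val y t.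
Proof.
apply: iff_trans (crat_lt_resP _ _ _) _.
apply: iff_trans (forcing_atP (fun e f : rat => e < f) a x y) _; split.
  apply: filterS3 (crat_val_ae x) (crat_val_ae y) => t [e te ->] [f tf ->] H ta.
  by rewrite ltr_rat; exact: H.
apply: filterS3 (crat_valE x) (crat_valE y) => t xE yE H ta e f te tf.
by rewrite -(ltr_rat R) -xE // -yE //; exact: H.
Qed.

Lemma crat_lt_aeP x y :
  crat_lt x y <-> \forall t \ae mu, crat_val x t < crat_val y t.
Proof.
rewrite -{1}[x](res_top (c := crat)) -{1}[y](res_top (c := crat)) crat_lt_res_aeP.
split; last by apply: filterS.
by apply: filterS2 (measalg_repr_top mu) => t ? ; exact.
Qed.

Lemma crat_gt0_aeP eps :
  crat_lt (cratc 0) eps <-> \forall t \ae mu, 0 < crat_val eps t.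
Proof.
rewrite crat_lt_aeP; split; apply: filterS2 (crat_val_const 0) => t ->;
  by rewrite rmorph0.
Qed.

Definition cseq_val (p : cseq A) (k : nat) : {mfun T >-> R} :=
  crat_val (p _ (gconst A k)).

                                                                           
(** Locality of conditional functions: on the piece where [n] equals [k], the index [n] and the
    constant [k] have the same restriction, hence so do the corresponding terms. *)
Lemma cseq_valE (p : cseq A) n : \forall t \ae mu,
  forall k, t \at gval n k -> crat_val (p _ n) t = cseq_val p k t.
Proof.
apply: ae_forall_count => k.
have : res crat (gval n k) (p _ n) = res crat (gval n k) (p _ (gconst A k)).
  rewrite -!cfun_res; apply: (congr1 (@cfun _ _ _ _ p (gval n k))).
  apply/gresP => c e f c0 cn ce /(gconst_le c0) <-.
  exact: gelt_uniq c0 ce cn.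
move=> /gresP/(forcing_atP (fun e f => e = f)).
apply: filterS3 (crat_val_ae (p _ n)) (crat_val_ae (p _ (gconst A k))).
by move=> t [e te ->] [f tf E] H tn; rewrite /cseq_val E (H tn _ _ te tf).
Qed.

Lemma measurable_lt_set (u v : T -> R) : measurable_fun setT u ->
  measurable_fun setT v -> measurable [set t | u t < v t].
Proof.
move=> mU mV.
rewrite (_ : mkset _ = (fun t => u t < v t) @^-1` [set true]); last first.
  by apply/seteqP; split=> t /=.
by rewrite -[X in measurable X]setTI; apply: measurable_fun_ltr.
Qed.

(** Exchanges a conditional threshold for pointwise ones. The converse direction selects the
    threshold measurably, which is where measurability of [Q] enters. *)
Lemma cnat_eventually (Q : nat -> nat -> T -> Prop) :
  (forall k l, measurable [set t | Q k l t]) ->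
  (exists n0 : cnat \top%O, forall m n : cnat \top%O, cnat_le n0 m -> cnat_le n0 n ->
     \forall t \ae mu, forall k l, t \at gval m k -> t \at gval n l -> Q k l t) <->
  \forall t \ae mu, exists N, forall k l, (N <= k)%N -> (N <= l)%N -> Q k l t.
Proof.
move=> mQ; split=> [[n0 n0P]|H].
  have : \forall t \ae mu, forall k l N, t \at gval n0 N ->
      (N <= k)%N -> (N <= l)%N -> Q k l t.
    apply: ae_forall_count => k; apply: ae_forall_count => l.
    (* The constant [k] need not dominate [n0] everywhere; the maximum does, and it still takes the
       value [k] wherever [n0] is at most [k]. *)
    pose m := cnat_max (gconst A k) n0; pose n := cnat_max (gconst A l) n0.
    have max_at j : \forall t \ae mu, forall N, t \at gval n0 N -> (N <= j)%N ->
        t \at gval (cnat_max (gconst A j) n0) j.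
      apply: filterS2 (gconst_at mu j) (gmap2_at maxn (gconst A j) n0).
      by move=> t tj H N tN Nj; have := H _ _ tj tN; rewrite (maxn_idPl Nj).
    apply: filterS3 (max_at k) (max_at l)
      (n0P m n (cnat_le_maxr _ _) (cnat_le_maxr _ _)).
    by move=> t Hk Hl HQ N tN Nk Nl; apply: HQ; [exact: Hk tN _|exact: Hl tN _].
  apply: filterS2 (gelt_at_ex n0) => t [N tN] HQ.
  by exists N => k l; exact: HQ.
have mimpl (b : bool) (B : set T) : measurable B -> measurable [set t | b -> B t].
  case: b => mB; [rewrite (_ : mkset _ = B) //|rewrite (_ : mkset _ = setT) //].
    by apply/seteqP; split=> t //=; exact.
  by apply/seteqP; split.
pose P (N : nat) t := forall k l, (N <= k)%N -> (N <= l)%N -> Q k l t.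
have mP N : measurable [set t | P N t].
  rewrite (_ : mkset _ = \bigcap_k \bigcap_l
      [set t | (N <= k)%N -> (N <= l)%N -> Q k l t]); last first.
    by apply/seteqP; split=> t Ht; [move=> k _ l _; exact: Ht|move=> k l; exact: Ht].
  apply: bigcapT_measurable => k; apply: bigcapT_measurable => l.
  exact: mimpl _ _ (mimpl _ _ (mQ k l)).
have [n0 n0P] := measurable_selection mP H.
exists n0 => m n /grel_atP n0m /grel_atP n0n.
have n0ex := gelt_at_ex n0.
apply: filterS3 (filterI n0ex n0P) n0m n0n => t [[N tN] tP] tm tn k l mk nl.
by apply: (tP _ tN); [exact: tm _ _ tN mk|exact: tn _ _ tN nl].
Qed.

(** Conditional and classical tolerances are equally strong: the constants $1/(j+1)$ suffice to
    control every real [e], and the value of a conditional [eps] at almost every point is just a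
    positive real. *)
Lemma cnat_eventually_lt a (u : nat -> nat -> T -> R) :
  (forall k l, measurable_fun setT (u k l)) ->
  (forall eps, crat_lt (cratc 0) eps ->
    exists n0 : cnat \top%O, forall m n : cnat \top%O, cnat_le n0 m -> cnat_le n0 n ->
     \forall t \ae mu, forall k l, t \at gval m k -> t \at gval n l ->
       t \at a -> u k l t < crat_val eps t) <->
  \forall t \ae mu, t \at a -> forall e : R, 0 < e ->
    exists N, forall k l, (N <= k)%N -> (N <= l)%N -> u k l t < e.
Proof.
move=> u_meas.
have mQ eps k l : measurable [set t | t \at a -> u k l t < crat_val eps t].
  rewrite (_ : mkset _ = ~` repr a `|` [set t | u k l t < crat_val eps t]).
    by apply: measurableU; [apply/measurableC/msetP|exact: measurable_lt_set].
  apply/seteqP; split=> t /=; last by case.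
  by move=> H; have [/H|] := pselect (t \at a); [right|left].
split=> H.
  have : \forall t \ae mu, forall j : nat, t \at a ->
      exists N, forall k l, (N <= k)%N -> (N <= l)%N -> u k l t < j.+1%:R^-1.
    apply: ae_forall_count => j.
    have jP : crat_lt (cratc 0) (cratc j.+1%:R^-1 : crat \top%O).
      by apply: crat_gt0c; rewrite invr_gt0 ltr0n.
    have /(cnat_eventually (mQ _)) := H _ jP.
    apply: filterS2 (crat_val_const j.+1%:R^-1) => t E [N HN] ta.
    exists N => k l Nk Nl; have := HN k l Nk Nl ta.
    by rewrite E fmorphV /= ratr_nat.
  apply: filterS => t Ht ta e e0.
  (* With [j] the integer part of [e^-1], [j + 1] exceeds [e^-1], so [j.+1%:R^-1] is below [e]. *)
  have [N HN] := Ht (Num.trunc e^-1) ta; exists N => k l Nk Nl.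
  apply: lt_le_trans (HN k l Nk Nl) _.
  rewrite -[leRHS]invrK lef_pV2 ?posrE ?invr_gt0 // ?ltr0n //.
  by apply/ltW/truncnS_gt.
move=> eps /crat_gt0_aeP eps0; apply/(cnat_eventually (mQ _)).
apply: filterS2 H eps0 => t Ht e0.
have [ta|nta] := pselect (t \at a); last by exists 0%N.
by have [N HN] := Ht ta _ e0; exists N => k l Nk Nl _; exact: HN.
Qed.

Lemma cseq_val_dist (p q : cseq A) (m n : cnat \top%O) :
  \forall t \ae mu, forall k l, t \at gval m k -> t \at gval n l ->
    crat_val (crat_abs (crat_sub (p _ m) (q _ n))) t =
    `|cseq_val p k t - cseq_val q l t|.
Proof.
have abs_val := crat_val_map1 (crat_sub (p _ m) (q _ n)) (@ratr_norm R).
have sub_val := crat_val_map2 (p _ m) (q _ n) (rmorphB (@ratr R)).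
apply: filterS2 (filterI (cseq_valE p m) (cseq_valE q n)) (filterI abs_val sub_val).
by move=> t [pE qE] [-> ->] k l tk tl; rewrite (pE _ tk) (qE _ tl).
Qed.

Lemma ccauchy_aeP (p : cseq A) : ccauchy p <->
  \forall t \ae mu, cvgn (fun k => cseq_val p k t).
Proof.
(* The indices are swapped because [ccauchy] measures [q n - q m] for the pair [m], [n]. *)
pose u k l t := `|cseq_val p l t - cseq_val p k t|.
have u_meas k l : measurable_fun setT (u k l).
  by apply: measurableT_comp => //; exact: measurable_funB.
have [H1 H2] := cnat_eventually_lt \top%O u_meas.
split=> [pC|pC].
  have := H1; set Z := forall eps, _ => {}H1.
  have /H1 : Z.
    move=> eps /pC[n0 n0P]; exists n0 => m n n0m n0n.
    have /crat_lt_aeP := n0P _ _ n0m n0n.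
    apply: filterS2 (cseq_val_dist p p n m) => t E lt k l tk tl _.
    by rewrite /u -(E _ _ tl tk).
  apply: filterS2 (measalg_repr_top mu) => t tt /(_ tt) Ht.
  apply/cauchy_cvgP/cauchy_exP => e /Ht[N HN].
  exists (cseq_val p N t); exists N => // k /= Nk.
  by rewrite /ball /= /u; exact: HN.
have {}/H2 H2 : \forall t \ae mu, t \at (\top%O : A) -> forall e : R, 0 < e ->
    exists N, forall k l, (N <= k)%N -> (N <= l)%N -> u k l t < e.
  apply: filterS pC => t /cvg_ex[/= l tl] _ e e0.
  have e20 : 0 < e / 2 by lra.
  have /cvgrPdist_lt/(_ _ e20)[N _ HN] := tl.
  exists N => m n Nm Nn; have := HN _ Nm; have := HN _ Nn => /=.
  by rewrite distrC /u; have := ler_distD l (cseq_val p n t) (cseq_val p m t); lra.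
move=> eps /H2[n0 n0P]; exists n0 => m n n0m n0n; apply/crat_lt_aeP.
apply: filterS3 (filterI (gelt_at_ex m) (gelt_at_ex n)) (cseq_val_dist p p n m)
  (filterI (measalg_repr_top mu) (n0P _ _ n0m n0n)).
by move=> t [[k tk] [l tl]] E [tt /(_ _ _ tk tl tt)]; rewrite (E _ _ tl tk).
Qed.

End Values.

(** * Pointwise limits of conditional Cauchy sequences *)

Section Limits.
Context (d : measure_display) (T : measurableType d) (R : realType).
Context (mu : {sigma_finite_measure set T -> \bar R}).
Local Notation A := (measalg mu).
Local Notation cnat := (@cnat _ A).
Local Notation crat := (@crat _ A).
Local Notation creal := (creal A).
Local Notation L0 := {mfun_ mu, T >-> R}.
Implicit Types (a b : A) (eps : crat \top%O) (p q : cauchyseq A) (f : L0).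

Lemma cauchyseq_lim_ex p : exists v : {mfun T >-> R},
  \forall t \ae mu, cseq_val p k t @[k --> \oo] --> v t.
Proof.
(* The upper limit is measurable on the whole space and equals the limit wherever the latter exists;
   [fine] sends infinite values to [0], which affects only a null set. *)
pose w t := fine (limn_esup (fun k => (cseq_val p k t)%:E)).
have mw : measurable_fun setT w.
  apply: measurableT_comp; first exact: fine_measurable.
  by apply: measurable_fun_limn_esup => k; exact/measurable_EFinP.
have wP : w \in mfun by rewrite inE.
exists (mfun_Sub wP); have /ccauchy_aeP := cauchyseqP p.
apply: filterS => t /cvg_ex[/= l tl].
rewrite [X in _ --> X](_ : _ = l) //.
have /cvg_limn_einf_sup[_ E] : (cseq_val p k t)%:E @[k --> \oo] --> l%:E.
  by apply: cvg_EFin => //; exact: nearW.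
by rewrite /= /w E.
Qed.

Definition cauchyseq_lim p : L0 := L0_class mu (projT1 (cid (cauchyseq_lim_ex p))).

Lemma cauchyseq_limE p :
  \forall t \ae mu, cseq_val p k t @[k --> \oo] --> cauchyseq_lim p t.
Proof.
rewrite /cauchyseq_lim; case: cid => v /= vP.
by apply: filterS2 (L0_classE mu v) vP => t ->.
Qed.

Lemma cauchyseq_lim_uniq p (w : T -> R) :
  (\forall t \ae mu, cseq_val p k t @[k --> \oo] --> w t) ->
  \forall t \ae mu, cauchyseq_lim p t = w t.
Proof. by apply: filterS2 (cauchyseq_limE p) => t; apply: cvg_unique. Qed.

(** One criterion for two uses: with [u] the distance of two sequences it decides equivalence, with
    [u] their difference it decides order. *)
Lemma cnat_eventually_cvg a (u : nat -> T -> R) (w : T -> R) :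
  (forall k, measurable_fun setT (u k)) ->
  (\forall t \ae mu, u k t @[k --> \oo] --> w t) ->
  (forall eps, crat_lt (cratc 0) eps ->
    exists n0 : cnat \top%O, forall n : cnat \top%O, cnat_le n0 n ->
     \forall t \ae mu, t \at a -> forall k, t \at gval n k ->
       u k t < crat_val eps t) <->
  \forall t \ae mu, t \at a -> w t <= 0.
Proof.
move=> mU uw.
have [H1 H2] := cnat_eventually_lt a (fun k _ : nat => mU k).
split=> [H|H eps eps0].
  apply: filterS2 (H1 _) uw => [t + tw ta|eps /H[n0 n0P]].
    move=> /(_ ta) tu; apply/ler_addgt0Pr => e e0; rewrite add0r.
    have [N HN] := tu _ e0; apply: cvgr_to_le tw _.
    by exists N => // k /= Nk; apply/ltW; exact: HN.
  exists n0 => m n n0m _; apply: filterS (n0P _ n0m) => t Ht k _ tk _ ta.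
  exact: Ht.
have [|n0 n0P] := H2 _ _ eps0.
  apply: filterS2 H uw => t + tw ta => /(_ ta) w0 e e0.
  have /cvgr_lt/(_ e (le_lt_trans w0 e0))[N _ HN] := tw.
  by exists N => k _ Nk _; exact: HN.
exists n0 => n n0n; apply: filterS2 (gelt_at_ex n) (n0P n n n0n n0n).
by move=> t [l tl] Ht ta k tk; exact: Ht tk tl ta.
Qed.

Lemma cauchyseq_eqv_aeP a p q : cauchyseq_eqv a p q <->
  \forall t \ae mu, t \at a -> cauchyseq_lim p t = cauchyseq_lim q t.
Proof.
pose u k t := `|cseq_val p k t - cseq_val q k t|.
have mU k : measurable_fun setT (u k).
  by apply: measurableT_comp => //; exact: measurable_funB.
have uw : \forall t \ae mu,
    u k t @[k --> \oo] --> `|cauchyseq_lim p t - cauchyseq_lim q t|.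
  apply: filterS2 (cauchyseq_limE p) (cauchyseq_limE q) => t pt qt.
  by apply: cvg_norm; apply: cvgB.
have lim_eq : (\forall t \ae mu, t \at a -> cauchyseq_lim p t = cauchyseq_lim q t) <->
    \forall t \ae mu, t \at a -> `|cauchyseq_lim p t - cauchyseq_lim q t| <= 0.
  by split; apply: filterS => t Ht /Ht; rewrite normr_le0 subr_eq0 => /eqP.
apply: iff_trans (iff_sym lim_eq); apply: iff_trans (cnat_eventually_cvg a mU uw).
split=> [/asboolP|] H; last apply/asboolP.
  move=> eps /H[n0 n0P]; exists n0 => n /n0P/crat_lt_res_aeP.
  apply: filterS2 (cseq_val_dist p q n n) => t E lt ta k tk.
  by rewrite /u -(E _ _ tk tk); exact: lt.
move=> eps /H[n0 n0P]; exists n0 => n n0n; apply/crat_lt_res_aeP.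
apply: filterS3 (gelt_at_ex n) (cseq_val_dist p q n n) (n0P _ n0n).
by move=> t [k tk] E lt ta; rewrite (E _ _ tk tk); exact: lt.
Qed.

(** Operations on the conditional reals go through chosen representatives; on [a] the limit does not
    see the choice. *)
Lemma cauchyseq_lim_repr a p : \forall t \ae mu, t \at a ->
  cauchyseq_lim (repr (creal_class a p)) t = cauchyseq_lim p t.
Proof. by apply/cauchyseq_eqv_aeP/creal_classE; rewrite /creal_class reprK. Qed.

Lemma cauchyseq_lim_repr_top p :
  cauchyseq_lim (repr (creal_class \top%O p)) = cauchyseq_lim p.
Proof.
apply/L0_eqP; apply: filterS2 (measalg_repr_top mu) (cauchyseq_lim_repr \top%O p).
by move=> t tt; exact.
Qed.

Lemma creal_le_aeP (x y : creal \top%O) : creal_le x y <->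
  L0_le (cauchyseq_lim (repr x)) (cauchyseq_lim (repr y)).
Proof.
set p := repr x; set q := repr y.
pose u k t := cseq_val p k t - cseq_val q k t.
have mU k : measurable_fun setT (u k) by exact: measurable_funB.
have uw : \forall t \ae mu,
    u k t @[k --> \oo] --> cauchyseq_lim p t - cauchyseq_lim q t.
  apply: filterS2 (cauchyseq_limE p) (cauchyseq_limE q) => t pt qt; exact: cvgB.
have lim_le : L0_le (cauchyseq_lim p) (cauchyseq_lim q) <->
    \forall t \ae mu, t \at (\top%O : A) ->
      cauchyseq_lim p t - cauchyseq_lim q t <= 0.
  split; first by apply: filterS => t Ht _; rewrite subr_le0.
  by apply: filterS2 (measalg_repr_top mu) => t tt /(_ tt); rewrite subr_le0.
apply: iff_trans (iff_sym lim_le); apply: iff_trans (cnat_eventually_cvg _ mU uw).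
have ltE eps (n : cnat \top%O) : \forall t \ae mu, forall k, t \at gval n k ->
    (crat_val (crat_opp eps) t < crat_val (crat_sub (q _ n) (p _ n)) t) =
    (u k t < crat_val eps t).
  have opp_val := crat_val_map1 eps (rmorphN (@ratr R)).
  have sub_val := crat_val_map2 (q _ n) (p _ n) (rmorphB (@ratr R)).
  apply: filterS2 (filterI (cseq_valE p n) (cseq_valE q n)) (filterI opp_val sub_val).
  move=> t [pE qE] [-> ->] k tk; rewrite (pE _ tk) (qE _ tk) /u /=.
  by apply/idP/idP; lra.
split=> H eps /H[n0 n0P]; exists n0 => n n0n.
  have /crat_lt_aeP := n0P _ n0n.
  by apply: filterS2 (ltE eps n) => t E lt _ k tk; rewrite -(E _ tk).
apply/crat_lt_aeP; apply: filterS3 (filterI (measalg_repr_top mu) (gelt_at_ex n))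
  (ltE eps n) (n0P _ n0n).
by move=> t [tt [k tk]] E /(_ tt _ tk); rewrite (E _ tk).
Qed.

(** The set where the limits coincide is measurable, so its class is a level at which [x] and [y]
    agree; strictness forces this class to be [\bot]. *)
Lemma creal_lt_aeP (x y : creal \top%O) : creal_lt x y <->
  \forall t \ae mu, cauchyseq_lim (repr x) t < cauchyseq_lim (repr y) t.
Proof.
set f := cauchyseq_lim _; set g := cauchyseq_lim _.
have res_eq a : creal_res a x = creal_res a y <->
    \forall t \ae mu, t \at a -> f t = g t.
  by rewrite creal_classE; exact: cauchyseq_eqv_aeP.
split=> [[/creal_le_aeP le H]|lt].
  have mE : measurable [set t | f t = g t].
    have -> : [set t | f t = g t] = (fun t => f t == g t) @^-1` [set true].
      by apply/seteqP; split=> t /= /eqP.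
    rewrite -[X in measurable X]setTI.
    by apply: (measurable_fun_eqr (measurable_funP _) (measurable_funP _)).
  have E := repr_mclass mu (MSet mE).
  have /H/measalg_eq_bot nE : creal_res (mclass mu (MSet mE)) x = creal_res _ y.
    by apply/res_eq; apply: filterS E => t H' /H'.
  apply: filterS3 le E nE => t le E nE.
  by rewrite lt_neqAle le andbT; apply/eqP => fg; apply/nE/E.
split; first by apply/creal_le_aeP; apply: filterS lt => t /ltW.
move=> a /res_eq H; apply/measalg_eq_bot.
by apply: filterS2 lt H => t lt H ta; move: lt; rewrite H // ltxx.
Qed.

Lemma cauchyseq_lim_map1 (h : rat -> rat) (H : R -> R) p q :
  (forall e, ratr (h e) = H (ratr e)) -> (forall x, {for x, continuous H}) ->
  (forall n : cnat \top%O, q _ n = gmap1 h (p _ n)) ->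
  \forall t \ae mu, cauchyseq_lim q t = H (cauchyseq_lim p t).
Proof.
move=> hH cH qE; apply: cauchyseq_lim_uniq.
have := ae_foralln (fun k => crat_val_map1 (p _ (gconst A k)) hH).
apply: filterS2 (cauchyseq_limE p) => t pt E.
under eq_cvg do rewrite /cseq_val qE E.
exact: continuous_cvg (cH _) pt.
Qed.

Lemma cauchyseq_lim_map2 (h : rat -> rat -> rat) (H : R -> R -> R) p q
    (r : cauchyseq A) :
  (forall x y, ratr (h x y) = H (ratr x) (ratr y)) ->
  (forall (u v : nat -> R) x y, u @ \oo --> x -> v @ \oo --> y ->
     H (u k) (v k) @[k --> \oo] --> H x y) ->
  (forall n : cnat \top%O, r _ n = gmap2 h (p _ n) (q _ n)) ->
  \forall t \ae mu, cauchyseq_lim r t = H (cauchyseq_lim p t) (cauchyseq_lim q t).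
Proof.
move=> hH cH rE; apply: cauchyseq_lim_uniq.
have := ae_foralln (fun k => crat_val_map2 (p _ (gconst A k)) (q _ (gconst A k)) hH).
apply: filterS3 (cauchyseq_limE p) (cauchyseq_limE q) => t pt qt E.
under eq_cvg do rewrite /cseq_val rE E.
exact: cH pt qt.
Qed.

Lemma cauchyseq_lim_const (e : rat) :
  \forall t \ae mu, cauchyseq_lim (cauchyseq_const A e) t = ratr e.
Proof.
apply: cauchyseq_lim_uniq; apply: filterS (crat_val_const mu e) => t E.
have -> : cseq_val (cauchyseq_const A e) ^~ t = cst (ratr e : R); last exact: cvg_cst.
by apply/funext => k; rewrite /cseq_val /= gres_top E.
Qed.

(** Density of the rationals gives approximations at each point, and measurable selection turns them
    into conditional rationals [q k]. Their pointwise convergence to [f] already implies the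
    conditional Cauchy property. *)
Lemma cauchyseq_lim_surj f : exists p, cauchyseq_lim p = f.
Proof.
have /choice[q qP] k : exists x : crat \top%O, \forall t \ae mu,
    forall e, t \at gval x e -> `|ratr e - f t| < k.+1%:R^-1.
  apply: measurable_selection => [e|].
    apply: measurable_lt_set => //; apply: measurableT_comp => //.
    exact: measurable_funB.
  apply: aeW => t; have k0 : (0 : R) < k.+1%:R^-1 by rewrite invr_gt0 ltr0n.
  have [|e] := @rat_in_itvoo R (f t - k.+1%:R^-1) (f t + k.+1%:R^-1).
    by rewrite ltrBlDr -addrA ltrDl addr_gt0.
  by rewrite in_itv /= => et; exists e; rewrite ltr_distl.
have q_cvg : \forall t \ae mu, cseq_val (cseq_of_terms q) k t @[k --> \oo] --> f t.
  have /ae_forall_count qd : forall k, \forall t \ae mu,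
      `|cseq_val (cseq_of_terms q) k t - f t| < k.+1%:R^-1.
    move=> k; apply: filterS2 (qP k) (crat_val_ae (q k)) => t H [e te E].
    by rewrite /cseq_val cseq_of_termsE E; exact: H.
  apply: filterS qd => t H; apply/cvgrPdist_lt => e e0.
  exists (Num.trunc e^-1) => // k /= ek; rewrite distrC.
  apply: lt_le_trans (H k) _.
  rewrite -[leRHS]invrK lef_pV2 ?posrE ?invr_gt0 // ?ltr0n //.
  apply: le_trans (ltW (truncnS_gt _)) _.
  by rewrite ler_nat ltnS.
have qC : ccauchy (cseq_of_terms q).
  by apply/ccauchy_aeP; apply: filterS q_cvg => t tq; apply/cvg_ex; exists (f t).
by exists (CauchySeq qC); apply/L0_eqP/cauchyseq_lim_uniq.
Qed.

End Limits.

(** * Transport of conditional topologies along conditional bijections *)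

Section Transport.
Context (d : Order.disp_t) (A : cboolAlgType d) (X Y : condset A).

(** Surjectivity at the top descends to every level because restrictions are surjective; injectivity
    at each level then makes the chosen preimages compatible with restriction. *)
Lemma cond_bijective_inverse (f : condfun X Y) :
  cond_bijective f -> exists g : condfun Y X, cond_inverse f g.
Proof.
move=> [finj fsurj].
have surj a (y : Y a) : exists x : X a, f a x = y.
  have [y' <-] := res_surj y; have [x <-] := fsurj y'.
  by exists (res X a x); rewrite cfun_res.
pose g a (y : Y a) : X a := projT1 (cid (surj a y)).
have fg a (y : Y a) : f a (g a y) = y by rewrite /g; case: cid.
have g_res a (y : Y \top%O) : g a (res Y a y) = res X a (g _ y).
  by apply: (finj a); rewrite fg cfun_res fg.
exists (CondFun g g_res) => a; split=> x; last exact: fg.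
by apply: (finj a); exact: fg.
Qed.

Section Inverse.
Context (f : condfun X Y) (g : condfun Y X) (fg : cond_inverse f g).

Lemma cpreimage_cgen (S : set (Y \top%O)) :
  cpreimage f (cgen S) = cgen (@cfun _ _ _ _ f \top%O @^-1` S).
Proof.
apply/functional_extensionality_dep => a; apply/seteqP; split=> x /=.
  move=> [y Sy yx]; exists (g _ y); first by rewrite /= (fg _).2.
  by rewrite -cfun_res yx (fg _).1.
by move=> [x' Sx <-]; exists (f _ x'); rewrite // cfun_res.
Qed.

Lemma cpreimage_stable (S : set (Y \top%O)) :
  stable_set S -> stable_set (@cfun _ _ _ _ f \top%O @^-1` S).
Proof.
move=> [[y Sy] SP]; split; first by exists (g _ y); rewrite /= (fg _).2.
move=> I a x z aP Sx zx; apply: (SP _ a (fun i => f _ (x i))) => // i.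
by rewrite -!cfun_res zx.
Qed.

Lemma cpreimage_csubset (O : cfamily Y) :
  is_csubset O -> is_csubset (cpreimage f O).
Proof.
move=> [a [S [SP ->]]]; exists a, (@cfun _ _ _ _ f \top%O @^-1` S).
by split; [exact: cpreimage_stable|rewrite -cpreimage_cgen].
Qed.

Lemma cpreimage_cunion (I : Type) (O : I -> cfamily Y) :
  cpreimage f (cunion O) = cunion (fun i => cpreimage f (O i)).
Proof.
apply/functional_extensionality_dep => a; apply/seteqP.
split=> x /= [J [b [i [y [bP xy yO]]]]]; exists J, b, i.
  exists (g _ y); split=> // [|j]; first by rewrite -cfun_res -xy (fg _).1.
  by rewrite /cpreimage /= cfun_res (fg _).2; exact: yO.
exists (f _ y); split=> // [|j]; first by rewrite xy cfun_res.
by rewrite -cfun_res; exact: yO.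
Qed.

End Inverse.

Lemma cpreimageK (f : condfun X Y) (g : condfun Y X) (O : cfamily Y) :
  cond_inverse f g -> cpreimage g (cpreimage f O) = O.
Proof.
move=> fg; apply/functional_extensionality_dep => a; apply/funext => y.
by rewrite /cpreimage /= (fg a).2.
Qed.

End Transport.

Lemma cond_inverse_sym (d : Order.disp_t) (A : cboolAlgType d) (X Y : condset A)
    (f : condfun X Y) (g : condfun Y X) : cond_inverse f g -> cond_inverse g f.
Proof. by move=> fg a; have [] := fg a. Qed.

(** Preimage under a conditional bijection commutes with intersections, unions and gluings. *)
Lemma ctopology_transport (d : Order.disp_t) (A : cboolAlgType d)
    (X Y : condset A) (f : condfun X Y) (g : condfun Y X) (TX : set (cfamily X)) :
  cond_inverse f g -> is_ctopology TX ->
  is_ctopology [set O : cfamily Y | TX (cpreimage f O)].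
Proof.
move=> fg [sub [tot empt] inter union glue]; split=> /=.
(* [O] is the preimage under [g] of its own preimage under [f], hence a conditional subset. *)
- move=> O /sub/(cpreimage_csubset (cond_inverse_sym fg)).
  by rewrite (cpreimageK O fg).
- by split; [exact: tot|exact: empt].
- by move=> O1 O2 T1 T2; exact: inter.
- by move=> I O TO; rewrite (cpreimage_cunion fg); exact: union.
- by move=> I a O aP TO; rewrite /cglue (cpreimage_cunion fg); exact: glue.
Qed.

(** A generated topology is the intersection of all topologies containing its base. Any topology
    [TX] containing [BX] transports to one containing [BY], hence containing every generated open
    set. *)
Lemma generated_continuous (d : Order.disp_t) (A : cboolAlgType d)
    (X Y : condset A) (f : condfun X Y) (g : condfun Y X)
    (BX : set (cfamily X)) (BY : set (cfamily Y)) :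
  cond_inverse f g -> (forall V, BY V -> BX (cpreimage f V)) ->
  cond_continuous (ctopology_generated BX) (ctopology_generated BY) f.
Proof.
move=> fg fB O OP TX TXtop TXB.
apply: (OP _ (ctopology_transport fg TXtop)) => V /fB; exact: TXB.
Qed.

(** * The isomorphism between the conditional reals and $\mathbf{L^0}$ *)

Section Isomorphism.
Context (d : measure_display) (T : measurableType d) (R : realType).
Context (mu : {sigma_finite_measure set T -> \bar R}).
Local Notation A := (measalg mu).
Local Notation L0 := {mfun_ mu, T >-> R}.

(** [L0_mk a] cuts the limit down to [a], since off [a] it depends on the representative. *)
Definition creal_to_L0_fun (a : A) (x : creal A a) : condL0 mu a :=
  L0_mk a (cauchyseq_lim (repr x)).

Lemma creal_to_L0_res (a : A) (x : creal A \top%O) :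
  creal_to_L0_fun (res (creal A) a x) = res (condL0 mu) a (creal_to_L0_fun x).
Proof.
apply: L0_val_inj; rewrite /= L0_restr_top; apply/L0_restrP.
exact: cauchyseq_lim_repr.
Qed.

Definition creal_to_L0 : condfun (creal A) (condL0 mu) :=
  CondFun creal_to_L0_fun creal_to_L0_res.

Lemma creal_to_L0_val (x : creal A \top%O) :
  condL0_val (creal_to_L0 _ x) = cauchyseq_lim (repr x).
Proof. exact: L0_restr_top. Qed.

Lemma creal_to_L0_bijective : cond_bijective creal_to_L0.
Proof.
split=> [a x y /(congr1 (@L0_val _ _ _ _ _))/L0_restrP xy|g].
  rewrite -[x]reprK -[y]reprK; apply/creal_classE; exact/cauchyseq_eqv_aeP.
have [p pg] := cauchyseq_lim_surj (L0_val g).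
exists (creal_class \top%O p); apply: L0_val_inj; rewrite -pg.
exact: etrans (creal_to_L0_val _) (cauchyseq_lim_repr_top _).
Qed.

Lemma cauchyseq_lim_add (p q : cauchyseq A) : \forall t \ae mu,
  cauchyseq_lim (cauchyseq_add p q) t = cauchyseq_lim p t + cauchyseq_lim q t.
Proof.
apply: (cauchyseq_lim_map2 (rmorphD (@ratr R))) => // u v x y.
exact: cvgD.
Qed.

Lemma cauchyseq_lim_sub (p q : cauchyseq A) : \forall t \ae mu,
  cauchyseq_lim (cauchyseq_sub p q) t = cauchyseq_lim p t - cauchyseq_lim q t.
Proof.
apply: (cauchyseq_lim_map2 (rmorphB (@ratr R))) => // u v x y.
exact: cvgB.
Qed.

Lemma cauchyseq_lim_mul (p q : cauchyseq A) : \forall t \ae mu,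
  cauchyseq_lim (cauchyseq_mul p q) t = cauchyseq_lim p t * cauchyseq_lim q t.
Proof.
apply: (cauchyseq_lim_map2 (rmorphM (@ratr R))) => // u v x y.
exact: cvgM.
Qed.

Lemma cauchyseq_lim_abs (p : cauchyseq A) : \forall t \ae mu,
  cauchyseq_lim (cauchyseq_abs p) t = `|cauchyseq_lim p t|.
Proof.
apply: (cauchyseq_lim_map1 (@ratr_norm R)) => // x.
exact: norm_continuous.
Qed.

Lemma creal_add_lim (x y : creal A \top%O) : cauchyseq_lim (repr (creal_add x y)) =
  L0_add (cauchyseq_lim (repr x)) (cauchyseq_lim (repr y)).
Proof.
rewrite cauchyseq_lim_repr_top; apply/L0_eqP.
have classE := L0_classE mu
  (repr (cauchyseq_lim (repr x)) + repr (cauchyseq_lim (repr y))).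
apply: filterS2 classE (cauchyseq_lim_add (repr x) (repr y)) => t E ->.
by rewrite /L0_add E.
Qed.

Lemma creal_mul_lim (x y : creal A \top%O) : cauchyseq_lim (repr (creal_mul x y)) =
  L0_mul (cauchyseq_lim (repr x)) (cauchyseq_lim (repr y)).
Proof.
rewrite cauchyseq_lim_repr_top; apply/L0_eqP.
have classE := L0_classE mu
  (repr (cauchyseq_lim (repr x)) * repr (cauchyseq_lim (repr y))).
apply: filterS2 classE (cauchyseq_lim_mul (repr x) (repr y)) => t E ->.
by rewrite /L0_mul E.
Qed.

Lemma creal_dist_lim (x y : creal A \top%O) : \forall t \ae mu,
  cauchyseq_lim (repr (creal_abs (creal_sub x y))) t =
  `|cauchyseq_lim (repr x) t - cauchyseq_lim (repr y) t|.
Proof.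
rewrite cauchyseq_lim_repr_top.
apply: filterS2 (cauchyseq_lim_abs (repr (creal_sub x y)))
  (cauchyseq_lim_sub (repr x) (repr y)) => t ->.
by rewrite cauchyseq_lim_repr_top => ->.
Qed.

Lemma creal_gt0_aeP (x : creal A \top%O) : creal_lt (creal_zero A) x <->
  \forall t \ae mu, 0 < cauchyseq_lim (repr x) t.
Proof.
rewrite creal_lt_aeP cauchyseq_lim_repr_top.
by split; apply: filterS2 (cauchyseq_lim_const mu 0) => t ->; rewrite rmorph0.
Qed.

(** Both balls are generated by sets at the top level, so it suffices to compare these: distance and
    strict order are read off pointwise from the limits. *)
Lemma cpreimage_L0_ball psi (x eps : creal A \top%O) :
  cond_inverse creal_to_L0 psi ->
  cpreimage creal_to_L0
    (L0_ball (cauchyseq_lim (repr x)) (cauchyseq_lim (repr eps))) =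
  creal_ball x eps.
Proof.
move=> phi_psi; rewrite /L0_ball (cpreimage_cgen phi_psi); congr cgen.
apply/funext => y.
rewrite -[LHS]/(\forall t \ae mu, `|cauchyseq_lim (repr x) t -
  condL0_val (creal_to_L0 _ y) t| < cauchyseq_lim (repr eps) t) creal_to_L0_val.
apply/propext; apply: iff_trans (iff_sym (creal_lt_aeP _ _)).
by split; apply: filterS2 (creal_dist_lim x y) => t ->.
Qed.

End Isomorphism.

Theorem theorem4p5 (d : measure_display) (T : measurableType d) (R : realType)
    (mu : {sigma_finite_measure set T -> \bar R}) :
  exists (phi : condfun (creal (measalg mu)) (condL0 mu))
         (psi : condfun (condL0 mu) (creal (measalg mu))),
    (cond_bijective phi /\ cond_inverse phi psi) /\
    (forall x y : creal (measalg mu) \top%O,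
       condL0_val (phi _ (creal_add x y)) =
       L0_add (condL0_val (phi _ x)) (condL0_val (phi _ y))) /\
    (forall x y : creal (measalg mu) \top%O,
       condL0_val (phi _ (creal_mul x y)) =
       L0_mul (condL0_val (phi _ x)) (condL0_val (phi _ y))) /\
    (forall x y : creal (measalg mu) \top%O,
       creal_le x y <-> L0_le (condL0_val (phi _ x)) (condL0_val (phi _ y))) /\
    (cond_continuous (creal_open (measalg mu)) (L0_open mu) phi /\
     cond_continuous (L0_open mu) (creal_open (measalg mu)) psi).
Proof.
have phi_bij := creal_to_L0_bijective mu.
have [psi phi_psi] := cond_bijective_inverse phi_bij.
exists (creal_to_L0 mu), psi; do ?split => //.
- by move=> x y; rewrite !creal_to_L0_val creal_add_lim.
- by move=> x y; rewrite !creal_to_L0_val creal_mul_lim.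
- by rewrite !creal_to_L0_val => /creal_le_aeP.
- by rewrite !creal_to_L0_val => /creal_le_aeP.
- apply: (generated_continuous phi_psi) => _ [f [eps [eps0 ->]]].
  (* Centre and radius of an $L^0$-ball are themselves limits, so its preimage is a ball of the
     conditional reals. *)
  have [p pf] := cauchyseq_lim_surj f; have [q qeps] := cauchyseq_lim_surj eps.
  exists (creal_class \top%O p), (creal_class \top%O q); split.
    by apply/creal_gt0_aeP; rewrite cauchyseq_lim_repr_top qeps.
  by rewrite -(cpreimage_L0_ball _ _ phi_psi) !cauchyseq_lim_repr_top pf qeps.
- apply: (generated_continuous (cond_inverse_sym phi_psi)).
  move=> _ [x [eps [/creal_gt0_aeP eps0 ->]]].
  (* A ball of the conditional reals is the preimage of an $L^0$-ball under [creal_to_L0]; pulling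
     it back along [psi] returns that $L^0$-ball. *)
  exists (cauchyseq_lim (repr x)), (cauchyseq_lim (repr eps)); split => //.
  by rewrite -(cpreimage_L0_ball _ _ phi_psi) (cpreimageK _ phi_psi).
Qed.
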